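(* Suppose there exist constants $\delta>0$ and $0<\varepsilon<1$ such that $D(\delta|i,a,b)\le 1-\varepsilon$ for all $(i,a,b)\in S\times A\times B$. Then the value function $V^*:\mathcal P(K)\times S\to\mathbb R$ of the semi-Markov game with incomplete information satisfies the optimality equation $$V^*=\overline T V^*=\underline T V^*,$$ that is, $V^*(p,i)=\overline T V^*(p,i)=\underline T V^*(p,i)$ for all $p\in\mathcal P(K)$ and $i\in S$.
   Context: Model. $K,S,A,B$ are finite nonempty sets (game types, states, actions of Player 1, actions of Player 2). For a finite set $E$, $\mathcal P(E)$ is the set of probability distributions on $E$. $Q(\cdot,\cdot|i,a,b)$ is a semi-Markov kernel on $[0,\infty)\times S$ given $S\times A\times B$: for all $i,j,a,b$, $t\mapsto Q(t,j|i,a,b)$ is nondecreasing, right continuous, nonnegative, with $Q(0,j|i,a,b)=0$; $\sum_{j}Q(t,j|i,a,b)\le 1$ for all $t$; and $\sum_j\lim_{t\to\infty}Q(t,j|i,a,b)=1$. Put $D(t|i,a,b):=\sum_{j\in S}Q(t,j|i,a,b)$. The payoff rate is $c:K\times S\times A\times B\to[0,\infty)$, and $\alpha>0$ is a fixed discount factor. Policies. $\mathcal H_n=(S\times A\times B)^n\times S$ is the set of histories $h_n=(i_0,a_0,b_0,\dots,a_{n-1},b_{n-1},i_n)$. $\Pi$ is the set of policies of Player 1, i.e. families $\pi=\{\pi_n^{(k)}:k\in K,n\ge0\}$ of stochastic kernels $\pi_n^{(k)}(\cdot|h_n)\in\mathcal P(A)$, $h_n\in\mathcal H_n$. $\Sigma$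 is the set of policies of Player 2, i.e. families $\sigma=\{\sigma_n:n\ge0\}$ of stochastic kernels $\sigma_n(\cdot|h_n)\in\mathcal P(B)$. Probability. On $\Omega=K\times(S\times A\times B\times[0,\infty))^\infty$ with product $\sigma$-algebra, for $\omega=(k,i_0,a_0,b_0,t_1,i_1,a_1,b_1,t_2,\dots)$ put $\kappa=k$, $X_n=i_n$, $A_n=a_n$, $B_n=b_n$, $T_0=0$, $T_{n}=\sum_{m=1}^{n}t_m$, $H_n=(X_0,A_0,B_0,\dots,A_{n-1},B_{n-1},X_n)$, $T_\infty=\lim_nT_n$. For $p\in\mathcal P(K)$, $i\in S$, $\pi\in\Pi$, $\sigma\in\Sigma$, $\mathbb P_{p,i}^{\pi,\sigma}$ (expectation $\mathbb E_{p,i}^{\pi,\sigma}$) is the unique probability measure with $\mathbb P(X_0=i,\kappa=k)=p_k$; $\mathbb P(A_n=a,B_n=b|\kappa,H_n,T_n)=\pi_n^{(\kappa)}(a|H_n)\sigma_n(b|H_n)$; $\mathbb P(T_{n+1}-T_n\le t,X_{n+1}=j|\kappa,H_n,T_n,A_n,B_n)=Q(t,j|X_n,A_n,B_n)$. Payoff and value. For $t\in[T_n,T_{n+1})$ the continuous-time processes (written with subscript $t$) take the values $X_n,A_n,B_n$. The expected discounted reward is $V(p,i,\pi,\sigma)=\mathbb E_{p,i}^{\pi,\sigma}\big[\int_0^{T_\infty}e^{-\alpha t}c(\kappa,X_t,A_t,B_t)\,dt\big]$. Lower and upper values: $\underline V(p,i)=\sup_{\pi\in\Pi}\inf_{\sigma\in\Sigma}V(p,i,\pi,\sigma)$,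 $\overline V(p,i)=\inf_{\sigma\in\Sigma}\sup_{\pi\in\Pi}V(p,i,\pi,\sigma)$. When they coincide the common value is denoted $V^*(p,i)$ (the value function); under the hypothesis of the claim they coincide for all $(p,i)$. Operators. $\Pi[0]$ is the set of families $\mu=\{\mu^{(k)}(\cdot|i)\in\mathcal P(A):k\in K,i\in S\}$ and $\Sigma[0]$ the set of families $\nu=\{\nu(\cdot|i)\in\mathcal P(B):i\in S\}$. For $\gamma=\{\gamma^{(k)}\in\mathcal P(A):k\in K\}$, $a\in A$, $p\in\mathcal P(K)$, let $\Lambda_{\gamma,a}(p)\in\mathcal P(K)$ be $\Lambda_{\gamma,a}(p)(k)=\gamma^{(k)}(a)p_k/\sum_{l\in K}\gamma^{(l)}(a)p_l$ (an arbitrary fixed element of $\mathcal P(K)$ if the denominator is $0$; below it is then multiplied by $0$). For $u:\mathcal P(K)\times S\to\mathbb R$, $$T^{\mu,\nu}u(p,i)=\sum_{k\in K}\sum_{a\in A,b\in B}p_k\mu^{(k)}(a|i)\nu(b|i)c(k,i,a,b)\int_0^\infty e^{-\alpha t}(1-D(t|i,a,b))\,dt+\sum_{k\in K}\sum_{a\in A,b\in B}p_k\mu^{(k)}(a|i)\nu(b|i)\sum_{j\in S}\int_0^\infty e^{-\alpha t}Q(dt,j|i,a,b)\,u(\Lambda_{\mu(\cdot|i),a}(p),j),$$ $\overline Tu(p,i)=\inf_{\nu\in\Sigma[0]}\sup_{\mu\in\Pi[0]}T^{\mu,\nu}u(p,i)$ and $\underline Tu(p,i)=\sup_{\mu\in\Pi[0]}\inf_{\nu\in\Sigma[0]}T^{\mu,\nu}u(p,i)$.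 *)

(* Defs.v *)
From HB Require Import structures.
From mathcomp Require Import all_boot all_order all_algebra.
From mathcomp Require Import all_classical all_reals all_analysis.

Set Implicit Arguments.
Unset Strict Implicit.
Unset Printing Implicit Defensive.

Import Order.TTheory GRing.Theory Num.Theory.
Import numFieldNormedType.Exports.

Local Open Scope classical_set_scope.
Local Open Scope ring_scope.

(* Finite nonempty sets: the point is only a witness of nonemptiness, which
   MathComp-Analysis requires in order to build a measurableType. *)
#[short(type="finPointedType")]
HB.structure Definition FinPointed := {T of Finite T & Pointed T}.

(* The set P(E) of probability distributions on a finite set E. *)
Section fdist.
Variables (R : realType) (E : finType).

Definition is_fdist (f : {ffun E -> R}) : bool :=
  [forall x, 0 <= f x] && (\sum_x f x == 1).

Record fdist := FDist { pmf :> {ffun E -> R}; fdistP : is_fdist pmf }.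

HB.instance Definition _ := [isSub for pmf].
End fdist.

(* Q i a b j t is Q(t, j | i, a, b). [cumulative R R] is the type of the
   nondecreasing right-continuous functions R -> R. The functions
   Q(., j | i, a, b), given on [0, +oo[, are extended by 0 to ]-oo, 0[, so that
   [lebesgue_stieltjes_measure (Q i a b j)] is the measure Q(dt, j | i, a, b). *)
Definition kernel_on (R : realType) (S A B : finType) : Type :=
  S -> A -> B -> S -> cumulative R R.

Section semi_markov_kernel.
Variables (R : realType) (S A B : finType) (Q : kernel_on R S A B).

Definition sojourn_cdf (i : S) (a : A) (b : B) (t : R) : R :=
  \sum_(j : S) Q i a b j t.

Record semi_markov_kernel : Prop := SemiMarkovKernel {
  kernel_neg : forall i a b j t, t < 0 -> Q i a b j t = 0;
  kernel_zero : forall i a b j, Q i a b j 0 = 0;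
  kernel_ge0 : forall i a b j t, 0 <= t -> 0 <= Q i a b j t;
  kernel_le1 : forall i a b t, 0 <= t -> sojourn_cdf i a b t <= 1;
  kernel_lim1 : forall i a b, \sum_(j : S) lim (Q i a b j t @[t --> +oo]) = 1
}.
End semi_markov_kernel.

Section policies.
Variables (R : realType) (K S A B : finType).

(* ((i_0, a_0, b_0), ..., (i_{n-1}, a_{n-1}, b_{n-1})) and i_n. *)
Definition history (n : nat) : Type := (n.-tuple (S * A * B) * S)%type.

Definition policy1 : Type := K -> forall n : nat, history n -> fdist R A.
Definition policy2 : Type := forall n : nat, history n -> fdist R B.
End policies.

HB.instance Definition _ (R : realType) :=
  isPointed.Build {itv R & `[0, +oo[} (0%:nng).

Section sample_space.
Variables (R : realType) (K S A B : finPointedType).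

(* w = (k, i_0, a_0, b_0, t_1, i_1, a_1, b_1, t_2, ...) is encoded as the pair
   of k and of the sequence n |-> (i_n, a_n, b_n, t_{n+1}). *)
Definition play : Type := (K * (nat -> S * A * B * {nonneg R}))%type.
HB.instance Definition _ := Pointed.on play.

Definition gtype (w : play) : K := w.1.
Definition state (w : play) (n : nat) : S := (w.2 n).1.1.1.
Definition action1 (w : play) (n : nat) : A := (w.2 n).1.1.2.
Definition action2 (w : play) (n : nat) : B := (w.2 n).1.2.
Definition sojourn (w : play) (n : nat) : R := (w.2 n).2%:num.

Definition jump_time (w : play) (n : nat) : R := \sum_(0 <= m < n) sojourn w m.
Definition explosion_time (w : play) : \bar R :=
  limn (fun n => (jump_time w n)%:E).
Definition hist (n : nat) (w : play) : history S A B n :=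
  ([tuple (w.2 m).1 | m < n], state w n).

(* The product sigma-algebra is the one generated by the coordinate maps. *)
Definition coordinate_events : set (set play) :=
  [set C | (exists k, C = [set w | gtype w = k])
        \/ exists n,
          [\/ exists i, C = [set w | state w n = i],
              exists a, C = [set w | action1 w n = a],
              exists b, C = [set w | action2 w n = b]
            | exists2 U : set R, measurable U & C = [set w | U (sojourn w n)]]].

Definition Omega : Type := g_sigma_algebraType coordinate_events.
HB.instance Definition _ := Measurable.on Omega.

(* sigma(kappa, H_n, T_n) *)
Definition sigma_before (n : nat) : set (set play) :=
  <<s [set C | [\/ exists k, C = [set w | gtype w = k],
                   exists h, C = [set w | hist n w = h]
                 | exists2 U : set R, measurable U
                   & C = [set w | U (jump_time w n)]]] >>.

(* sigma(kappa, H_n, T_n, A_n, B_n) *)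
Definition sigma_after (n : nat) : set (set play) :=
  <<s [set C | sigma_before n C
            \/ (exists a, C = [set w | action1 w n = a])
            \/ (exists b, C = [set w | action2 w n = b])] >>.
End sample_space.

(* f is a version of the conditional probability P(E | G), where G is a
   sub-sigma-algebra. *)
Definition is_condprob (R : realType) (d : measure_display)
    (T : measurableType d) (P : probability T R) (G : set (set T)) (E : set T)
    (f : T -> R) : Prop :=
  (forall U : set R, measurable U -> G (f @^-1` U)) /\
  (forall C : set T, G C -> P (C `&` E) = (\int[P]_(w in C) (f w)%:E)%E).

Section game.
Variables (R : realType) (K S A B : finPointedType).
Variables (Q : kernel_on R S A B) (c : K -> S -> A -> B -> R) (alpha : R).

Local Notation Omega := (Omega R K S A B).
Local Notation policy1 := (policy1 R K S A B).
Local Notation policy2 := (policy2 R S A B).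

Record is_game_law (p : fdist R K) (i : S) (pi : policy1) (sg : policy2)
    (P : probability Omega R) : Prop := IsGameLaw {
  law_initial : forall k,
    P [set w | state w 0 = i /\ gtype w = k] = (p k)%:E;
  law_actions : forall n a b,
    is_condprob P (@sigma_before R K S A B n)
      [set w | action1 w n = a /\ action2 w n = b]
      (fun w => pi (gtype w) n (hist n w) a * sg n (hist n w) b);
  law_transition : forall n (t : R) j, 0 <= t ->
    is_condprob P (@sigma_after R K S A B n)
      [set w | jump_time w n.+1 - jump_time w n <= t /\ state w n.+1 = j]
      (fun w => Q (state w n) (action1 w n) (action2 w n) j t)
}.

(* The n with T_n <= t < T_{n+1}; it exists, and is unique, iff
   0 <= t < T_infty. *)
Definition epoch (w : play R K S A B) (t : R) : nat :=
  get [set n | jump_time w n <= t < jump_time w n.+1].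

Definition discounted_reward (w : play R K S A B) : \bar R :=
  (\int[@lebesgue_measure R]_(t in [set t | (0 <= t)%R /\
                                            t%:E < explosion_time w])
     (expR (- (alpha * t)) *
      c (gtype w) (state w (epoch w t))
        (action1 w (epoch w t)) (action2 w (epoch w t)))%:E)%E.

Section value.
Variable Pr : fdist R K -> S -> policy1 -> policy2 -> probability Omega R.

Definition payoff (p : fdist R K) (i : S) (pi : policy1) (sg : policy2) :
    \bar R :=
  (\int[Pr p i pi sg]_w discounted_reward w)%E.

Definition lower_value (p : fdist R K) (i : S) : \bar R :=
  ereal_sup (range (fun pi => ereal_inf (range (fun sg => payoff p i pi sg)))).

Definition upper_value (p : fdist R K) (i : S) : \bar R :=
  ereal_inf (range (fun sg => ereal_sup (range (fun pi => payoff p i pi sg)))).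

Definition is_value_function (V : fdist R K -> S -> R) : Prop :=
  forall p i, lower_value p i = (V p i)%:E /\ upper_value p i = (V p i)%:E.
End value.

Section operators.
(* The arbitrary distribution used where Bayes' rule is undefined. *)
Variable p0 : fdist R K.

(* When the denominator is 0, the quotients below are all 0, hence do not form
   a distribution, and [insubd] returns p0. *)
Definition posterior (gamma : K -> fdist R A) (a : A) (p : fdist R K) :
    fdist R K :=
  insubd p0 [ffun k => gamma k a * p k / \sum_(l : K) gamma l a * p l].

Definition mean_discount (i : S) (a : A) (b : B) : R :=
  \int[@lebesgue_measure R]_(t in `[0, +oo[)
    (expR (- (alpha * t)) * (1 - sojourn_cdf Q i a b t)).

Definition discounted_transition (i : S) (a : A) (b : B) (j : S) : R :=
  \int[lebesgue_stieltjes_measure (Q i a b j)]_(t in `[0, +oo[)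
    expR (- (alpha * t)).

Definition Tmunu (mu : K -> S -> fdist R A) (nu : S -> fdist R B)
    (u : fdist R K -> S -> R) (p : fdist R K) (i : S) : R :=
  \sum_(k : K) \sum_(a : A) \sum_(b : B)
    p k * mu k i a * nu i b * c k i a b * mean_discount i a b
  + \sum_(k : K) \sum_(a : A) \sum_(b : B)
    p k * mu k i a * nu i b *
      \sum_(j : S) discounted_transition i a b j *
                   u (posterior (fun l => mu l i) a p) j.

(* Extended-real valued, since u is arbitrary. *)
Definition Tupper (u : fdist R K -> S -> R) (p : fdist R K) (i : S) : \bar R :=
  ereal_inf (range (fun nu =>
    ereal_sup (range (fun mu => (Tmunu mu nu u p i)%:E)))).

Definition Tlower (u : fdist R K -> S -> R) (p : fdist R K) (i : S) : \bar R :=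
  ereal_sup (range (fun mu =>
    ereal_inf (range (fun nu => (Tmunu mu nu u p i)%:E)))).
End operators.
End game.

(* Main.v *)
(** Since the law of (kappa, H_n, A_n, B_n) discounted by exp(-alpha T_n) is a
product of p, the policies and the numbers q(i,a,b,j) = E exp(-alpha t_1), the
payoff is that of a discrete-time game with stage reward c * mean_discount and
substochastic transitions q, whose mass is at most beta < 1 by the hypothesis
on the sojourn times. Write u and w for the lower and the upper value.

Playing mu first and then a nearly optimal policy for the posterior, player 1
guarantees T^(mu, sigma_0) u up to epsilon against every sigma; hence
Tlower u <= u and Tupper u <= w.

Conversely w <= Tlower w. Once player 2's whole policy sigma is fixed, the types
of player 1 face separate decision problems, so it suffices that player 1
chooses a first action for each type, a finite set of rows. By Kuhn's
realization of mixtures by behavioral policies the best reward after each row is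
convex-like in sigma, so a minimax theorem with finitely many rows yields a
first move mu good against every sigma; player 2 answers it by an arbitrary nu
followed by a nearly optimal policy for the posterior.

As Tlower contracts by beta, Tlower u <= u <= w <= Tlower w forces u = w, and
then w <= Tlower w <= Tupper w <= w. *)

Require Import Defs.
From mathcomp Require Import all_boot all_order all_algebra.
From mathcomp Require Import all_classical all_reals all_analysis.
From HB Require Import structures.
From mathcomp Require Import measurable_realfun.
From mathcomp Require Import ring lra.

Set Implicit Arguments.
Unset Strict Implicit.
Unset Printing Implicit Defensive.

Import Order.TTheory GRing.Theory Num.Theory.
Import numFieldNormedType.Exports.

Local Open Scope classical_set_scope.
Local Open Scope ring_scope.

(** * Distributions, suprema and infima, and a minimax theorem *)

Section fdist_facts.
Variables (R : realType) (E : finType).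
Implicit Types f g : fdist R E.

Lemma fdist_ge0 f x : 0 <= f x.
Proof. by case: f => f /= /andP[/forallP]. Qed.

Lemma fdist_sum1 f : \sum_x f x = 1.
Proof. by case: f => f /= /andP[_ /eqP]. Qed.

Lemma fdist_of (h : E -> R) : (forall x, 0 <= h x) -> \sum_x h x = 1 ->
  exists f : fdist R E, forall x, f x = h x.
Proof.
move=> h0 h1.
have Hf : is_fdist (finfun h).
  apply/andP; split; first by apply/forallP => x; rewrite ffunE.
  by rewrite -h1; apply/eqP; apply: eq_bigr => x _; rewrite ffunE.
by exists (FDist Hf) => x; rewrite /= ffunE.
Qed.

Lemma exists_fdist (x0 : E) : exists f : fdist R E, True.
Proof.
have [||f _] := @fdist_of (fun x => (x == x0)%:R).
- by move=> x; rewrite ler0n.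
- by rewrite (bigD1 x0)//= eqxx big1 ?addr0// => x /negbTE->.
by exists f.
Qed.

Lemma le_fdist_mean f (h : E -> R) (v : R) :
  (forall x, h x <= v) -> \sum_x f x * h x <= v.
Proof.
move=> hv; rewrite -[leRHS]mul1r -(fdist_sum1 f) mulr_suml.
by apply: ler_sum => x _; rewrite ler_wpM2l// fdist_ge0.
Qed.

Lemma ge_fdist_mean f (h : E -> R) (v : R) :
  (forall x, v <= h x) -> v <= \sum_x f x * h x.
Proof.
move=> hv; rewrite -[leLHS]mul1r -(fdist_sum1 f) mulr_suml.
by apply: ler_sum => x _; rewrite ler_wpM2l// fdist_ge0.
Qed.

Lemma insubd_fdist f (h : {ffun E -> R}) x :
  (forall x, 0 <= h x) -> \sum_x h x = 1 -> insubd f h x = h x.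
Proof.
move=> h0 h1; rewrite /insubd insubT//.
by apply/andP; split; [exact/forallP|exact/eqP].
Qed.

(* When [w1 + w2 = 0] the quotients are 0 and [insubd] returns [f]. *)
Definition conv2 (w1 w2 : R) f g : fdist R E :=
  insubd f [ffun x => (w1 * f x + w2 * g x) / (w1 + w2)].

(** Multiplying by the total weight instead of dividing keeps the identity true when both weights
    vanish. *)
Lemma conv2E (w1 w2 : R) f g x : 0 <= w1 -> 0 <= w2 ->
  (w1 + w2) * conv2 w1 w2 f g x = w1 * f x + w2 * g x.
Proof.
move=> w10 w20; have [w0|w0] := eqVneq (w1 + w2) 0.
  have [-> ->] : w1 = 0 /\ w2 = 0 by split; lra.
  by rewrite !mul0r !addr0 mul0r.
rewrite /conv2 insubd_fdist; first by rewrite ffunE mulrC divfK.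
- by move=> y; rewrite ffunE divr_ge0 ?addr_ge0 ?mulr_ge0 ?fdist_ge0.
- under eq_bigr do rewrite ffunE.
  by rewrite -mulr_suml big_split/= -!mulr_sumr !fdist_sum1 !mulr1 divff.
Qed.

End fdist_facts.

(** * Suprema and infima of bounded real families *)

Section bounded_sup_inf.
Variables (R : realType) (T : Type).
Implicit Types f : T -> R.

(** Real suprema and infima are meaningful only for nonempty bounded ranges, so the lemmas below
    carry a bound and, where needed, a point of the domain. *)
Definition range_sup f : R := sup (range f).
Definition range_inf f : R := inf (range f).

Lemma range_sup_ub f (M : R) x : (forall x, f x <= M) -> f x <= range_sup f.
Proof.
move=> fM; apply: ub_le_sup; last by exists x.
by exists M => _ [y _ <-].
Qed.

Lemma range_inf_lb f (m : R) x : (forall x, m <= f x) -> range_inf f <= f x.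
Proof.
move=> fM; apply: ge_inf; last by exists x.
by exists m => _ [y _ <-].
Qed.

Lemma range_sup_le (x0 : T) f (v : R) :
  (forall x, f x <= v) -> range_sup f <= v.
Proof.
move=> fv; apply: ge_sup; first by exists (f x0); exists x0.
by move=> _ [y _ <-].
Qed.

Lemma le_range_inf (x0 : T) f (v : R) :
  (forall x, v <= f x) -> v <= range_inf f.
Proof.
move=> fv; apply: lb_le_inf; first by exists (f x0); exists x0.
by move=> _ [y _ <-].
Qed.

Lemma range_sup_approx (x0 : T) f (M e : R) : (forall x, f x <= M) -> 0 < e ->
  exists x, range_sup f - e <= f x.
Proof.
move=> fM e0.
have [|_ [x _ <-] /ltW H] := @sup_adherent _ (range f) e e0.
  by split; [exists (f x0); exists x0|exists M => _ [y _ <-]].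
by exists x.
Qed.

Lemma range_inf_approx (x0 : T) f (m e : R) : (forall x, m <= f x) -> 0 < e ->
  exists x, f x <= range_inf f + e.
Proof.
move=> fM e0.
have [|_ [x _ <-] /ltW H] := @inf_adherent _ (range f) e e0.
  by split; [exists (f x0); exists x0|exists m => _ [y _ <-]].
by exists x.
Qed.

Lemma ereal_sup_range (x0 : T) f (M : R) : (forall x, f x <= M) ->
  ereal_sup (range (fun x => (f x)%:E)) = (range_sup f)%:E.
Proof.
move=> fM; rewrite -ereal_sup_EFin; last 2 first.
- by exists M => _ [y _ <-].
- by exists (f x0); exists x0.
by rewrite -image_comp.
Qed.

Lemma ereal_inf_range (x0 : T) f (m : R) : (forall x, m <= f x) ->
  ereal_inf (range (fun x => (f x)%:E)) = (range_inf f)%:E.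
Proof.
move=> fM; rewrite -ereal_inf_EFin; last 2 first.
- by exists m => _ [y _ <-].
- by exists (f x0); exists x0.
by rewrite -image_comp.
Qed.

End bounded_sup_inf.

(** * A minimax theorem with finitely many rows *)

Section minimax.
Variables (R : realType) (Y : Type).

(** Ky Fan's notion: [Y] needs no linear structure, provided that one point serves all the rows at
    once. Policies of player 2, mixed through [kuhn_mix], are of this kind. *)
Definition convexlike (I : Type) (s : I -> Prop) (D : set Y)
    (F : I -> Y -> R) :=
  forall y1 y2 t, D y1 -> D y2 -> 0 <= t <= 1 ->
  exists2 y, D y & forall i, s i -> F i y <= t * F i y1 + (1 - t) * F i y2.

(** A point with [G y < 0] forces [t] to be at least [- G y / (F y - G y)], and one with [F y < 0]
    forces it to be at most [G y / (G y - F y)]. Convexity puts every lower constraint below every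
    upper one, so the supremum of the set [L] of lower constraints works; 0 is added to make [L]
    nonempty. *)
Lemma minimax_two (D : set Y) (F G : Y -> R) :
  (forall y1 y2 t, D y1 -> D y2 -> 0 <= t <= 1 -> exists2 y, D y &
     F y <= t * F y1 + (1 - t) * F y2 /\ G y <= t * G y1 + (1 - t) * G y2) ->
  (forall y, D y -> 0 <= F y \/ 0 <= G y) ->
  exists2 t, 0 <= t <= 1 & forall y, D y -> 0 <= t * F y + (1 - t) * G y.
Proof.
move=> cvx FG.
pose L := [set x | x = 0 \/
  exists y, [/\ D y, G y < 0 & x = - G y / (F y - G y)]].
have L1 x : L x -> 0 <= x <= 1.
  case=> [->|[y [Dy Gy ->]]]; first by lra.
  have [Fy|] := FG _ Dy; last by lra.
  by rewrite ler_pdivrMr ?divr_ge0; lra.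
have L0 : L !=set0 by exists 0; left.
have Lub : has_ubound L by exists 1 => x /L1 /andP[].
have [t0 t1] : 0 <= sup L /\ sup L <= 1.
  split; first by apply: ub_le_sup => //; left.
  by apply: ge_sup => // x /L1 /andP[].
exists (sup L) => [|y Dy]; first by apply/andP.
have [Gy|Gy] := ltP (G y) 0.
  have [Fy|] := FG _ Dy; last by lra.
  have : - G y / (F y - G y) <= sup L.
    by apply: ub_le_sup => //; right; exists y.
  by rewrite ler_pdivrMr; [lra|lra].
have [Fy|Fy] := leP 0 (F y).
  by rewrite addr_ge0// mulr_ge0//; lra.
suff : sup L <= G y / (G y - F y) by rewrite ler_pdivlMr; lra.
apply: ge_sup => // x [->|[z [Dz Gz ->]]]; first by rewrite divr_ge0//; lra.
have [Fz|] := FG _ Dz; last by lra.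
(* Cross-multiplied, this says that the lower constraint of [z] lies below the upper constraint of
   [y]. *)
have key : F y * G z <= G y * F z.
  rewrite leNgt; apply/negP => lt.
  (* Some mixture of y and z makes both F and G negative. *)
  have dF : 0 < F z - F y by lra.
  have dG : 0 < G y - G z by lra.
  (* With weight [s] on [y], the mixed value of [F] is negative once [s > s1], that of [G] as long
     as [s < s2]. *)
  set s1 := F z / (F z - F y); set s2 := - G z / (G y - G z).
  have e1 : s1 * (F z - F y) = F z by rewrite divfK// gt_eqF.
  have e2 : s2 * (G y - G z) = - G z by rewrite divfK// gt_eqF.
  have s10 : 0 <= s1 by rewrite divr_ge0// ltW.
  have s21 : s2 <= 1 by rewrite ler_pdivrMr// mul1r; lra.
  have s12 : s1 < s2.
    rewrite /s1 /s2 ltr_pdivrMr// mulrAC ltr_pdivlMr//; lra.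
  have [|w Dw [Fw Gw]] := cvx y z ((s1 + s2) / 2) Dy Dz.
    by apply/andP; split; lra.
  have Fw0 : F w < 0.
    apply: le_lt_trans Fw _.
    have : 0 < (s2 - s1) * (F z - F y) by rewrite mulr_gt0// subr_gt0.
    by lra.
  have Gw0 : G w < 0.
    apply: le_lt_trans Gw _.
    have : 0 < (s2 - s1) * (G y - G z) by rewrite mulr_gt0// subr_gt0.
    by lra.
  by case: (FG _ Dw); lra.
rewrite ler_pdivrMr; last lra.
rewrite mulrAC ler_pdivlMr; lra.
Qed.

(* Induction on the rows: on the set where the first row is negative, the other
   rows satisfy the hypothesis. *)
Lemma minimax_seq (I : eqType) (s : seq I) (D : set Y) (F : I -> Y -> R) :
  uniq s -> s != [::] -> convexlike (fun i => i \in s) D F ->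
  (forall y, D y -> exists2 i, i \in s & 0 <= F i y) ->
  exists l : I -> R, [/\ forall i, 0 <= l i, \sum_(i <- s) l i = 1 &
    forall y, D y -> 0 <= \sum_(i <- s) l i * F i y].
Proof.
elim: s D => [//|i0 s IH] D /= /andP[i0s us] _ cvx pos.
have [s0|s0] := eqVneq s [::].
  exists (fun=> 1); split=> [//||y Dy]; rewrite s0 ?big_seq1//.
  by have [i] := pos _ Dy; rewrite s0 inE => /eqP->; rewrite mul1r.
have [||l [l0 l1 lF]] := IH (D `&` [set y | F i0 y < 0]) us s0.
- move=> y1 y2 t [D1 F1] [D2 F2] t01.
  have [y Dy Fy] := cvx y1 y2 t D1 D2 t01.
  exists y => [|i si]; last by apply: Fy; rewrite inE si orbT.
  split=> //=; apply: le_lt_trans (Fy _ (mem_head _ _)) _.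
  rewrite /= in F1 F2.
  have [->|tn] := eqVneq t 0; first lra.
  by have : t * F i0 y1 < 0; [rewrite pmulr_rlt0//; lra|
     have : (1 - t) * F i0 y2 <= 0; [rewrite mulr_ge0_le0; lra|lra]].
- move=> y [Dy Fy]; have [i] := pos _ Dy.
  rewrite inE => /orP[/eqP->|si Fi]; last by exists i.
  by move=> /(lt_le_trans Fy); rewrite ltxx.
(* The row [i0] and the average of the other rows fall under the two-row case: wherever [F i0] is
   negative, [lF] applies. *)
have [||t /andP[t0 t1] tF] :=
    @minimax_two D (F i0) (fun y => \sum_(i <- s) l i * F i y).
- move=> y1 y2 t D1 D2 t01; have [y Dy Fy] := cvx _ _ _ D1 D2 t01.
  exists y => //; split; first by apply: Fy; exact: mem_head.
  rewrite !mulr_sumr -big_split/= big_seq [leRHS]big_seq.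
  apply: ler_sum => i si.
  have -> : t * (l i * F i y1) + (1 - t) * (l i * F i y2) =
    l i * (t * F i y1 + (1 - t) * F i y2) by ring.
  by rewrite ler_wpM2l// Fy// inE si orbT.
- move=> y Dy; have [Fy|Fy] := leP 0 (F i0 y); first by left.
  by right; apply: lF.
exists (fun i => if i == i0 then t else (1 - t) * l i).
have ne i : i \in s -> (i == i0) = false.
  by move=> si; apply: contraNF i0s => /eqP<-.
split.
- by move=> i; case: ifP => // _; rewrite mulr_ge0// subr_ge0.
- rewrite big_cons eqxx big_seq.
  under eq_bigr => i si do rewrite (ne _ si).
  by rewrite -big_seq -mulr_sumr l1; ring.
- move=> y Dy; rewrite big_cons eqxx big_seq.
  under eq_bigr => i si do rewrite (ne _ si) -mulrA.
  by rewrite -big_seq -mulr_sumr; exact: tF.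
Qed.

(** Finiteness of the set of rows stands in for compactness, as [Y] carries no topology. Subtracting
    [v] from every row reduces the claim to level 0. *)
Lemma minimax (I : finType) (i0 : I) (F : I -> Y -> R) (v : R) :
  convexlike (fun=> True) setT F -> (forall y, exists i, v <= F i y) ->
  exists l : fdist R I, forall y, v <= \sum_i l i * F i y.
Proof.
move=> cvx pos.
have [||||l [l0 l1 lF]] := @minimax_seq I (index_enum I) setT
    (fun i y => F i y - v).
- exact: index_enum_uniq.
- by apply/eqP => e; have := mem_index_enum i0; rewrite e.
- move=> y1 y2 t D1 D2 t01; have [y _ Fy] := cvx _ _ _ D1 D2 t01.
  by exists y => // i _; have := Fy i Logic.I; lra.
- move=> y _; have [i vi] := pos y.
  by exists i; [exact: mem_index_enum|rewrite subr_ge0].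
have [f fl] := fdist_of l0 l1; exists f => y.
have := lF y Logic.I; under eq_bigr do rewrite -fl mulrBr.
by rewrite sumrB -mulr_suml fdist_sum1 mul1r subr_ge0.
Qed.

End minimax.

(** * The discounted game with seq-indexed policies *)

Lemma cvgn_sum (R : realType) (I : Type) (s : seq I) (F : I -> nat -> R)
    (l : I -> R) : (forall i, F i @ \oo --> l i) ->
  \sum_(i <- s) F i n @[n --> \oo] --> \sum_(i <- s) l i.
Proof.
move=> Fl; elim: s => [|i s IH].
  rewrite big_nil; under eq_fun do rewrite big_nil; exact: cvg_cst.
by rewrite big_cons; under eq_fun do rewrite big_cons; exact: cvgD.
Qed.

Section discrete_game.
Variables (R : realType) (K S A B : finPointedType).

(* Policies are indexed by untyped lists of past moves, so that dropping the
   first move of a history needs no cast. *)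
Definition seq_policy (E : finType) := seq (S * A * B) -> S -> fdist R E.

Definition drop_move (E : finType) (x : S * A * B) (tau : seq_policy E) :
  seq_policy E := fun s => tau (x :: s).

(** The state in which a play with past [s] and present state [i] began. *)
Definition first_state (s : seq (S * A * B)) (i : S) : S :=
  head i [seq x.1.1 | x <- s].

(** A continuation may depend on the first move and on the state that follows it; that state is
    recovered from the rest of the history. *)
Definition glue (E : finType) (nu : S -> fdist R E)
    (cont : S * A * B -> S -> seq_policy E) : seq_policy E :=
  fun s i => if s is x :: s' then cont x (first_state s' i) s' i else nu i.

(** Equality of policies would be too strong: a glued policy agrees with its continuation [cont x j]
    only on histories starting in [j]. *)
Definition agree_from (E : finType) (j : S) (tau tau' : seq_policy E) :=
  forall s i, first_state s i = j -> tau s i = tau' s i.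

Lemma agree_from_drop_move (E : finType) j a b (tau tau' : seq_policy E) j' :
  agree_from j tau tau' ->
  agree_from j' (drop_move (j, a, b) tau) (drop_move (j, a, b) tau').
Proof. by move=> h s i _; apply: h. Qed.

Lemma drop_move_glue (E : finType) nu (cont : S * A * B -> S -> seq_policy E)
    x j :
  agree_from j (drop_move x (glue nu cont)) (cont x j).
Proof. by move=> s i <-. Qed.

(* Player 2's behavioral form of the lottery that selects [sg1] and [sg2] with
   weights [w1] and [w2]: these weights are updated by the probabilities that
   [sg1] and [sg2] assign to the actions already played. *)
Fixpoint kuhn_mix (w1 w2 : R) (sg1 sg2 : seq_policy B)
    (s : seq (S * A * B)) (i : S) : fdist R B :=
  if s is x :: s' then
    kuhn_mix (w1 * sg1 [::] x.1.1 x.2) (w2 * sg2 [::] x.1.1 x.2)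
             (drop_move x sg1) (drop_move x sg2) s' i
  else conv2 w1 w2 (sg1 [::] i) (sg2 [::] i).

Variables (r : K -> S -> A -> B -> R) (q : S -> A -> B -> S -> R).
Variables (beta M : R).
Hypothesis r0 : forall k i a b, 0 <= r k i a b.
Hypothesis q0 : forall i a b j, 0 <= q i a b j.
Hypothesis q_beta : forall i a b, \sum_j q i a b j <= beta.
Hypothesis beta1 : beta < 1.
Hypothesis M0 : 0 <= M.
Hypothesis rM : forall k i a b, r k i a b + beta * M <= M.

(** The game truncated after [n] stages, unfolded from its first move; the discounting is contained
    in [q], whose mass stays below 1. *)
Fixpoint stage_reward (n : nat) (k : K) (i : S) (tau : seq_policy A)
    (sg : seq_policy B) : R :=
  if n is m.+1 then
    \sum_(a : A) tau [::] i a * \sum_(b : B) sg [::] i b *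
      (r k i a b + \sum_(j : S) q i a b j *
        stage_reward m k j (drop_move (i, a, b) tau) (drop_move (i, a, b) sg))
  else 0.

Lemma le_beta i a b (G : S -> R) (e : R) : 0 <= e -> (forall j, G j <= e) ->
  \sum_j q i a b j * G j <= beta * e.
Proof.
move=> e0 Ge; apply: (@le_trans _ _ (\sum_j q i a b j * e)).
  by apply: ler_sum => j _; rewrite ler_wpM2l.
by rewrite -mulr_suml ler_wpM2r.
Qed.

Lemma stage_reward_ge0 n k i tau sg : 0 <= stage_reward n k i tau sg.
Proof.
elim: n i tau sg => [|n IH] i tau sg //=.
apply: sumr_ge0 => a _; rewrite mulr_ge0 ?fdist_ge0//.
apply: sumr_ge0 => b _; rewrite mulr_ge0 ?fdist_ge0// addr_ge0//.
by apply: sumr_ge0 => j _; rewrite mulr_ge0.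
Qed.

(** The inequality [rM] makes [M] stable under one more discounted stage. *)
Lemma stage_reward_le n k i tau sg : stage_reward n k i tau sg <= M.
Proof.
elim: n i tau sg => [|n IH] i tau sg //=.
apply: le_fdist_mean => a; apply: le_fdist_mean => b.
by apply: le_trans (rM k i a b); rewrite lerD2l le_beta.
Qed.

Lemma stage_reward_nd k i tau sg :
  nondecreasing_seq (fun n => stage_reward n k i tau sg).
Proof.
apply/nondecreasing_seqP => n; elim: n i tau sg => [|n IH] i tau sg.
  exact: (stage_reward_ge0 1).
rewrite [leRHS]/= [leLHS]/=; apply: ler_sum => a _.
rewrite ler_wpM2l ?fdist_ge0//; apply: ler_sum => b _.
rewrite ler_wpM2l ?fdist_ge0// lerD2l; apply: ler_sum => j _.
by rewrite ler_wpM2l.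
Qed.

Lemma stage_reward_agree n k i tau tau' sg sg' :
  agree_from i tau tau' -> agree_from i sg sg' ->
  stage_reward n k i tau sg = stage_reward n k i tau' sg'.
Proof.
elim: n i tau tau' sg sg' => [|n IH] i tau tau' sg sg' h h' //=.
apply: eq_bigr => a _; rewrite h//; congr *%R.
apply: eq_bigr => b _; rewrite h'//; congr (_ * (_ + _)).
by apply: eq_bigr => j _; congr *%R; apply: IH; exact: agree_from_drop_move.
Qed.

(** Kuhn's argument: the reward is linear in the lottery. Unnormalized weights keep the induction
    going, since player 2's action [b] turns them into [w1'] and [w2'], whose total may be
    smaller. *)
Lemma stage_reward_mix n k i tau w1 w2 sg1 sg2 : 0 <= w1 -> 0 <= w2 ->
  (w1 + w2) * stage_reward n k i tau (kuhn_mix w1 w2 sg1 sg2) =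
  w1 * stage_reward n k i tau sg1 + w2 * stage_reward n k i tau sg2.
Proof.
elim: n i tau w1 w2 sg1 sg2 => [|n IH] i tau w1 w2 sg1 sg2 w10 w20.
  by rewrite /= !mulr0 addr0.
rewrite /= !mulr_sumr -big_split/=; apply: eq_bigr => a _.
rewrite !mulr_sumr -big_split/=; apply: eq_bigr => b _.
set w1' := w1 * sg1 [::] i b; set w2' := w2 * sg2 [::] i b.
have w'E : (w1 + w2) * conv2 w1 w2 (sg1 [::] i) (sg2 [::] i) b = w1' + w2'.
  exact: conv2E.
set x1 := drop_move _ sg1; set x2 := drop_move _ sg2.
have -> : drop_move (i, a, b) (kuhn_mix w1 w2 sg1 sg2) = kuhn_mix w1' w2' x1 x2.
  by [].
set y := \sum_j _; set y1 := \sum_j _; set y2 := \sum_j _.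
have yE : (w1' + w2') * y = w1' * y1 + w2' * y2.
  rewrite /y !mulr_sumr -big_split/=; apply: eq_bigr => j _.
  by rewrite mulrCA IH ?mulr_ge0 ?fdist_ge0//; ring.
transitivity (tau [::] i a * ((w1' + w2') * r k i a b + (w1' + w2') * y)).
  by rewrite -w'E; ring.
by rewrite yE /w1' /w2'; ring.
Qed.

Definition reward (k : K) (i : S) (tau : seq_policy A) (sg : seq_policy B) : R
  := range_sup (fun n => stage_reward n k i tau sg).

Lemma cvg_stage_reward k i tau sg :
  stage_reward n k i tau sg @[n --> \oo] --> reward k i tau sg.
Proof.
apply: nondecreasing_cvgn; first exact: stage_reward_nd.
by exists M => _ [n _ <-]; exact: stage_reward_le.
Qed.

Lemma reward_ge0 k i tau sg : 0 <= reward k i tau sg.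
Proof.
exact: (@range_sup_ub _ _ _ M 0%N (fun n => stage_reward_le n _ _ _ _)).
Qed.

Lemma reward_le k i tau sg : reward k i tau sg <= M.
Proof. by apply: (range_sup_le 0%N) => n; exact: stage_reward_le. Qed.

Lemma reward_agree k i tau tau' sg sg' :
  agree_from i tau tau' -> agree_from i sg sg' ->
  reward k i tau sg = reward k i tau' sg'.
Proof.
move=> h h'; rewrite /reward; congr range_sup; apply/funext => n.
exact: stage_reward_agree.
Qed.

Lemma reward_mix k i tau w1 w2 sg1 sg2 : 0 <= w1 -> 0 <= w2 ->
  (w1 + w2) * reward k i tau (kuhn_mix w1 w2 sg1 sg2) =
  w1 * reward k i tau sg1 + w2 * reward k i tau sg2.
Proof.
move=> w10 w20.
have h1 : (w1 + w2) * stage_reward n k i tau (kuhn_mix w1 w2 sg1 sg2)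
   @[n --> \oo] --> (w1 + w2) * reward k i tau (kuhn_mix w1 w2 sg1 sg2).
  by apply: cvgMr; exact: cvg_stage_reward.
have h2 : (w1 + w2) * stage_reward n k i tau (kuhn_mix w1 w2 sg1 sg2)
   @[n --> \oo] --> w1 * reward k i tau sg1 + w2 * reward k i tau sg2.
  rewrite (_ : (fun n => _) = (fun n => w1 * stage_reward n k i tau sg1 +
    w2 * stage_reward n k i tau sg2)); last first.
    by apply/funext => n; exact: stage_reward_mix.
  by apply: cvgD; apply: cvgMr; exact: cvg_stage_reward.
exact: (cvg_unique _ h1 h2).
Qed.

Lemma reward_step k i tau sg : reward k i tau sg =
  \sum_(a : A) tau [::] i a * \sum_(b : B) sg [::] i b *
    (r k i a b + \sum_(j : S) q i a b j *
      reward k j (drop_move (i, a, b) tau) (drop_move (i, a, b) sg)).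
Proof.
have h1 : stage_reward n.+1 k i tau sg @[n --> \oo] --> reward k i tau sg.
  by have := @cvg_stage_reward k i tau sg; rewrite -cvg_shiftS.
apply: (cvg_unique _ h1) => //=.
apply: cvgn_sum => a; apply: cvgMr; apply: cvgn_sum => b; apply: cvgMr.
apply: cvgD; first exact: cvg_cst.
by apply: cvgn_sum => j; apply: cvgMr; exact: cvg_stage_reward.
Qed.


(** * Posteriors and the values of the discrete game *)

Variable p0 : fdist R K.
Implicit Types (p : fdist R K) (pi : K -> seq_policy A) (sg : seq_policy B).

Definition pay p i pi sg : R := \sum_(k : K) p k * reward k i (pi k) sg.

Lemma pay_ge0 p i pi sg : 0 <= pay p i pi sg.
Proof. by apply: ge_fdist_mean => k; exact: reward_ge0. Qed.

Lemma pay_le p i pi sg : pay p i pi sg <= M.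
Proof. by apply: le_fdist_mean => k; exact: reward_le. Qed.

(** Bayes' rule without division. If the action [a] has probability 0, the left-hand side vanishes
    for every type, so the default [p0] does no harm. *)
Lemma posteriorE (gamma : K -> fdist R A) a p k :
  p k * gamma k a =
  (\sum_l p l * gamma l a) * posterior p0 gamma a p k.
Proof.
under eq_bigr do rewrite mulrC.
set d := \sum_l _.
have d0 : 0 <= d by apply: sumr_ge0 => l _; rewrite mulr_ge0 ?fdist_ge0.
have [dz|dn] := eqVneq d 0.
  rewrite dz mul0r mulrC; move: dz => /eqP.
  rewrite psumr_eq0 => [/allP/(_ k (mem_index_enum k))/eqP //|l _].
  by rewrite mulr_ge0 ?fdist_ge0.
rewrite /posterior insubd_fdist.
- by rewrite ffunE mulrCA divff// mulr1 mulrC.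
- by move=> y; rewrite ffunE divr_ge0// mulr_ge0 ?fdist_ge0.
- by under eq_bigr do rewrite ffunE; rewrite -mulr_suml divff.
Qed.

(** The continuation value [U] may depend on the public move only, not on the type. *)
Definition one_stage p i (mu : K -> fdist R A) (nu : fdist R B)
    (U : A -> B -> S -> R) : R :=
  \sum_k p k * \sum_a mu k a * \sum_b nu b *
    (r k i a b + \sum_j q i a b j * U a b j).

(** Given the action [a], neither player 2's action nor the transition depends on the type, so
    type-dependent continuations can be averaged under the posterior given [a] alone. *)
Lemma one_stage_posterior p i (mu : K -> fdist R A) (nu : fdist R B)
    (U : K -> A -> B -> S -> R) :
  \sum_k p k * (\sum_a mu k a * \sum_b nu b *
    (r k i a b + \sum_j q i a b j * U k a b j)) =
  one_stage p i mu nu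
    (fun a b j => \sum_l posterior p0 mu a p l * U l a b j).
Proof.
rewrite /one_stage.
under [LHS]eq_bigr do rewrite mulr_sumr.
under [RHS]eq_bigr do rewrite mulr_sumr.
rewrite exchange_big [RHS]exchange_big/=; apply: eq_bigr => a _.
pose d := \sum_l p l * mu l a.
pose W k := \sum_b nu b * (\sum_j q i a b j * U k a b j).
pose W' := \sum_b nu b * (\sum_j q i a b j *
  (\sum_l posterior p0 mu a p l * U l a b j)).
transitivity (\sum_k p k * mu k a * (\sum_b nu b * r k i a b) +
  \sum_k p k * mu k a * W k).
  rewrite -big_split/=; apply: eq_bigr => k _; rewrite -mulrDr mulrA.
  congr *%R; rewrite /W -big_split/=; apply: eq_bigr => b _.
  by rewrite mulrDr.
transitivity (\sum_k p k * mu k a * (\sum_b nu b * r k i a b) +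
  \sum_k p k * mu k a * W'); last first.
  rewrite -big_split/=; apply: eq_bigr => k _; rewrite -mulrDr mulrA.
  congr *%R; rewrite /W' -big_split/=; apply: eq_bigr => b _.
  by rewrite mulrDr.
congr +%R; rewrite -mulr_suml.
under eq_bigr do rewrite posteriorE -mulrA.
rewrite -mulr_sumr; congr *%R.
rewrite /W /W'; under eq_bigr do rewrite mulr_sumr.
rewrite exchange_big/=; apply: eq_bigr => b _.
under eq_bigr do rewrite mulrCA.
rewrite -mulr_sumr; congr *%R.
under eq_bigr do rewrite mulr_sumr.
rewrite exchange_big/=; apply: eq_bigr => j _.
by rewrite mulr_sumr; apply: eq_bigr => k _; rewrite mulrCA.
Qed.

Lemma pay_step p i pi sg : pay p i pi sg =
  one_stage p i (fun k => pi k [::] i) (sg [::] i) (fun a b j =>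
    pay (posterior p0 (fun k => pi k [::] i) a p) j
      (fun k => drop_move (i, a, b) (pi k)) (drop_move (i, a, b) sg)).
Proof.
rewrite /pay -one_stage_posterior; apply: eq_bigr => k _.
by rewrite reward_step.
Qed.

Lemma pay_agree p i pi pi' sg sg' :
  (forall k, agree_from i (pi k) (pi' k)) -> agree_from i sg sg' ->
  pay p i pi sg = pay p i pi' sg'.
Proof.
move=> h h'; apply: eq_bigr => k _; congr *%R; exact: reward_agree.
Qed.

(** The contraction comes from here: an error [e] in the continuation is weighted by the mass of
    [q], which is at most [beta]. *)
Lemma one_stage_le p i (mu : K -> fdist R A) (nu : fdist R B) U V e : 0 <= e ->
  (forall a b j, U a b j <= V a b j + e) ->
  one_stage p i mu nu U <= one_stage p i mu nu V + beta * e.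
Proof.
move=> e0 UV.
have -> : one_stage p i mu nu V + beta * e =
  \sum_k p k * \sum_a mu k a * \sum_b nu b *
    (r k i a b + \sum_j q i a b j * V a b j + beta * e).
  under [RHS]eq_bigr => k _.
    under eq_bigr => a _.
      under eq_bigr do rewrite mulrDr.
      rewrite big_split -mulr_suml fdist_sum1 mul1r mulrDr.
    over.
    rewrite big_split -mulr_suml fdist_sum1 mul1r mulrDr.
  over.
  by rewrite big_split -mulr_suml fdist_sum1 mul1r.
apply: ler_sum => k _; rewrite ler_wpM2l ?fdist_ge0//.
apply: ler_sum => a _; rewrite ler_wpM2l ?fdist_ge0//.
apply: ler_sum => b _; rewrite ler_wpM2l ?fdist_ge0//.
rewrite -addrA lerD2l.
apply: (@le_trans _ _ (\sum_j q i a b j * (V a b j + e))).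
  by apply: ler_sum => j _; rewrite ler_wpM2l.
under eq_bigr do rewrite mulrDr.
by rewrite big_split/= lerD2l -mulr_suml ler_wpM2r.
Qed.

Lemma one_stage_bounds p i (mu : K -> fdist R A) (nu : fdist R B) U :
  (forall a b j, 0 <= U a b j <= M) ->
  0 <= one_stage p i mu nu U <= M.
Proof.
move=> UM; apply/andP; split.
- apply: ge_fdist_mean => k; apply: ge_fdist_mean => a.
  apply: ge_fdist_mean => b; rewrite addr_ge0//; apply: sumr_ge0 => j _.
  by rewrite mulr_ge0//; have /andP[] := UM a b j.
- apply: le_fdist_mean => k; apply: le_fdist_mean => a.
  apply: le_fdist_mean => b; apply: le_trans (rM k i a b).
  by rewrite lerD2l le_beta// => j; have /andP[] := UM a b j.
Qed.

(** Fixed distributions and constant policies witness that the sets over which suprema and infima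
    are taken are nonempty. *)
Let exA : exists f : fdist R A, True := exists_fdist R (point : A).
Let exB : exists f : fdist R B, True := exists_fdist R (point : B).
Let fA : fdist R A := projT1 (cid exA).
Let fB : fdist R B := projT1 (cid exB).
Let pi0 : K -> seq_policy A := fun _ _ _ => fA.
Let sg0 : seq_policy B := fun _ _ => fB.

Definition lower p i : R := range_sup (fun pi => range_inf (pay p i pi)).
Definition upper p i : R :=
  range_inf (fun sg => range_sup (fun pi => pay p i pi sg)).

Let inf_pay_le p i pi sg : range_inf (pay p i pi) <= pay p i pi sg.
Proof. by apply: (@range_inf_lb _ _ _ 0) => sg'; exact: pay_ge0. Qed.

Let inf_pay_leM p i pi : range_inf (pay p i pi) <= M.
Proof. by apply: le_trans (inf_pay_le p i pi sg0) _; exact: pay_le. Qed.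

Let le_sup_pay p i pi sg : pay p i pi sg <= range_sup (pay p i ^~ sg).
Proof.
by apply: (@range_sup_ub _ _ (pay p i ^~ sg) M) => pi'; exact: pay_le.
Qed.

Let sup_pay_ge0 p i sg : 0 <= range_sup (pay p i ^~ sg).
Proof. exact: le_trans (pay_ge0 p i pi0 sg) (le_sup_pay _ _ _ _). Qed.

Lemma lower_bounds p i : 0 <= lower p i <= M.
Proof.
apply/andP; split; last by apply: (range_sup_le pi0) => pi; exact: inf_pay_leM.
apply: le_trans (range_sup_ub pi0 (inf_pay_leM p i)).
by apply: (le_range_inf sg0) => sg; exact: pay_ge0.
Qed.

Lemma upper_bounds p i : 0 <= upper p i <= M.
Proof.
apply/andP; split.
  by apply: (le_range_inf sg0) => sg; exact: sup_pay_ge0.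
apply: le_trans (range_inf_lb sg0 (sup_pay_ge0 p i)) _.
by apply: (range_sup_le pi0) => pi; exact: pay_le.
Qed.

Lemma lower_le_upper p i : lower p i <= upper p i.
Proof.
apply: (le_range_inf sg0) => sg; apply: (range_sup_le pi0) => pi.
exact: le_trans (inf_pay_le _ _ _ _) (le_sup_pay _ _ _ _).
Qed.

(** At one state the operator needs only the mixed actions used there, so [mu] and [nu] are not
    families over [S]. *)
Definition bellman (u : fdist R K -> S -> R) p i (mu : K -> fdist R A)
  (nu : fdist R B) : R :=
  one_stage p i mu nu (fun a _ j => u (posterior p0 mu a p) j).

Lemma bellman_bounds u p i (mu : K -> fdist R A) (nu : fdist R B) :
  (forall p i, 0 <= u p i <= M) ->
  0 <= bellman u p i mu nu <= M.
Proof. by move=> uM; apply: one_stage_bounds. Qed.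

(* Player 1 opens with [mu] and then plays nearly optimally from the posterior,
   which he knows since he knows [mu]. *)
Lemma bellman_lower_le p i (mu : K -> S -> fdist R A) e : 0 < e ->
  exists pi, forall sg,
    bellman lower p i (fun k => mu k i) (sg [::] i) - e <= pay p i pi sg.
Proof.
move=> e0.
have opt p' j : exists pi, lower p' j - e <= range_inf (pay p' j pi).
  exact: (range_sup_approx pi0 (inf_pay_leM p' j)).
have [c cP] := choice (fun x => opt x.1 x.2).
pose post a := posterior p0 (fun k => mu k i) a p.
pose pi k := glue (mu k) (fun x j => c (post x.1.2, j) k).
exists pi => sg; rewrite pay_step lerBlDr.
apply: (@le_trans _ _ (one_stage p i (fun k => mu k i) (sg [::] i)
  (fun a b j => pay (post a) j (fun k => drop_move (i, a, b) (pi k))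
                    (drop_move (i, a, b) sg)) + beta * e)); last first.
  by rewrite lerD2l ger_pMl// ltW.
apply: one_stage_le; first exact: ltW.
move=> a b j; rewrite -lerBlDr.
rewrite (@pay_agree _ _ _ (c (post a, j)) _ (drop_move (i, a, b) sg))//;
  last first.
  by move=> k; exact: drop_move_glue.
exact: le_trans (cP (post a, j)) (inf_pay_le _ _ _ _).
Qed.

(** The policy given by [bellman_lower_le] does not depend on [sg], and [sg [::] i] is one of the
    [nu] in the infimum. *)
Lemma lower_supersolution p i (mu : K -> fdist R A) :
  range_inf (bellman lower p i mu) <= lower p i.
Proof.
apply/ler_addgt0Pr => e e0.
have [pi piP] := bellman_lower_le p i (fun k _ => mu k) e0.
apply: (@le_trans _ _ (range_inf (pay p i pi) + e)); last first.
  by rewrite lerD2r; exact: (range_sup_ub pi (inf_pay_leM p i)).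
rewrite -lerBlDr; apply: (le_range_inf sg0) => sg.
apply: le_trans (piP sg); rewrite lerD2r.
apply: (@range_inf_lb _ _ _ 0) => nu.
by have /andP[] := bellman_bounds p i mu nu lower_bounds.
Qed.

(** Player 1 may answer the first mixed action of a given [sg] by any [mu]; the continuation then
    guarantees [lower] at the posterior up to [e]. *)
Lemma upper_ge_bellman_lower p i :
  range_inf (fun nu => range_sup (fun mu => bellman lower p i mu nu)) <=
  upper p i.
Proof.
apply: (le_range_inf sg0) => sg.
have bd mu nu := bellman_bounds p i mu nu lower_bounds.
apply: (@le_trans _ _ (range_sup (bellman lower p i ^~ (sg [::] i)))).
  apply: (@range_inf_lb _ _ _ 0) => nu.
  apply: (@le_trans _ _ (bellman lower p i (fun=> fA) nu)).
    by have /andP[] := bd (fun=> fA) nu.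
  apply: (@range_sup_ub _ _ _ M (fun=> fA)) => mu.
  by have /andP[] := bd mu nu.
apply: (range_sup_le (fun=> fA)) => mu; apply/ler_addgt0Pr => e e0.
have [pi piP] := bellman_lower_le p i (fun k _ => mu k) e0.
rewrite -lerBlDr; exact: le_trans (piP sg) (le_sup_pay _ _ _ _).
Qed.

(** Against a fixed [sg] each type solves a decision problem of its own, with value [best];
    [opening] is its value once the first action is imposed. *)
Let best k j sg : R := range_sup (fun tau => reward k j tau sg).

Let opening k i a sg : R := \sum_(b : B) sg [::] i b *
  (r k i a b + \sum_(j : S) q i a b j * best k j (drop_move (i, a, b) sg)).

Let tau0 : seq_policy A := fun _ _ => fA.

Let le_best k j tau sg : reward k j tau sg <= best k j sg.
Proof.
by apply: (@range_sup_ub _ _ (reward k j ^~ sg) M) => tau'; exact: reward_le.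
Qed.

Lemma reward_le_opening k i tau sg :
  reward k i tau sg <= \sum_a tau [::] i a * opening k i a sg.
Proof.
rewrite reward_step; apply: ler_sum => a _; rewrite ler_wpM2l ?fdist_ge0//.
apply: ler_sum => b _; rewrite ler_wpM2l ?fdist_ge0// lerD2l.
by apply: ler_sum => j _; rewrite ler_wpM2l.
Qed.

(** A supremum of functions that are linear along [kuhn_mix] is convex along it. *)
Lemma best_mix k j w1 w2 sg1 sg2 : 0 <= w1 -> 0 <= w2 ->
  (w1 + w2) * best k j (kuhn_mix w1 w2 sg1 sg2) <=
  w1 * best k j sg1 + w2 * best k j sg2.
Proof.
move=> w10 w20; have [w0|w0] := eqVneq (w1 + w2) 0.
  have [-> ->] : w1 = 0 /\ w2 = 0 by split; lra.
  by rewrite addr0 !mul0r addr0.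
have w_gt0 : 0 < w1 + w2 by rewrite lt0r w0 addr_ge0.
rewrite mulrC -ler_pdivlMr//; apply: (range_sup_le tau0) => tau.
rewrite ler_pdivlMr// mulrC reward_mix//.
by apply: lerD; rewrite ler_wpM2l.
Qed.

(** Convexity survives the first stage: after player 2's action [b] the mixture continues with
    updated weights, to which [best_mix] applies. *)
Lemma opening_mix k i a w1 w2 sg1 sg2 : 0 <= w1 -> 0 <= w2 ->
  (w1 + w2) * opening k i a (kuhn_mix w1 w2 sg1 sg2) <=
  w1 * opening k i a sg1 + w2 * opening k i a sg2.
Proof.
move=> w10 w20; rewrite /opening !mulr_sumr -big_split/=.
apply: ler_sum => b _; rewrite mulrA conv2E//.
set w1' := w1 * sg1 [::] i b; set w2' := w2 * sg2 [::] i b.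
have w1'0 : 0 <= w1' by rewrite mulr_ge0 ?fdist_ge0.
have w2'0 : 0 <= w2' by rewrite mulr_ge0 ?fdist_ge0.
set x1 := drop_move _ sg1; set x2 := drop_move _ sg2.
have -> : drop_move (i, a, b) (kuhn_mix w1 w2 sg1 sg2) = kuhn_mix w1' w2' x1 x2.
  by [].
set y := \sum_j _; set y1 := \sum_j _; set y2 := \sum_j _.
have yE : (w1' + w2') * y <= w1' * y1 + w2' * y2.
  rewrite /y !mulr_sumr -big_split/=; apply: ler_sum => j _.
  rewrite mulrCA (mulrCA w1') (mulrCA w2') -mulrDr ler_wpM2l//.
  exact: best_mix.
by rewrite !mulrA -/w1' -/w2' !mulrDr; lra.
Qed.

(** A policy of player 1 is one plan per type, so near-optimal plans for the separate problems
    combine into one policy. *)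
Lemma sum_best_le p j sg :
  \sum_k p k * best k j sg <= range_sup (pay p j ^~ sg).
Proof.
apply/ler_addgt0Pr => e e0.
have opt k : exists tau, best k j sg - e <= reward k j tau sg.
  by apply: (range_sup_approx tau0 _ e0) => tau; exact: reward_le.
have [pi piP] := choice opt.
apply: (@le_trans _ _ (pay p j pi sg + e)); last by rewrite lerD2r.
rewrite -[e in leRHS]mul1r -(fdist_sum1 p) mulr_suml -big_split/=.
apply: ler_sum => k _; rewrite -mulrDr ler_wpM2l ?fdist_ge0//.
by rewrite -lerBlDr.
Qed.

(** The rows are the functions giving each type a first action. Their payoffs are sums over types,
    so only the marginals of the minimax weights matter, and these are the [mu k]. *)
Lemma upper_le_opening p i : exists mu : K -> fdist R A, forall sg,
  upper p i <= \sum_k p k * \sum_a mu k a * opening k i a sg.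
Proof.
pose F (f : {ffun K -> A}) sg := \sum_k p k * opening k i (f k) sg.
have [|sg|l lP] := @minimax _ _ _ [ffun=> point] F (upper p i).
- move=> sg1 sg2 t _ _ /andP[t0 t1]; exists (kuhn_mix t (1 - t) sg1 sg2) => //.
  move=> f _; rewrite /F !mulr_sumr -big_split/=; apply: ler_sum => k _.
  rewrite mulrCA (mulrCA (1 - t)) -mulrDr ler_wpM2l ?fdist_ge0//.
  have /= := @opening_mix k i (f k) t (1 - t) sg1 sg2 t0.
  by rewrite subr_ge0 => /(_ t1); rewrite subrKC mul1r.
(* Against [sg], the row that picks a best first action for every type reaches at least
   [upper p i]. *)
- have max k : exists a, forall a', opening k i a' sg <= opening k i a sg.
    case: (@arg_maxP _ _ A point xpredT (fun a => opening k i a sg)) => //.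
    by move=> a _ h; exists a => a'; exact: h.
  have [f fP] := choice max; exists (finfun f).
  apply: le_trans (range_inf_lb sg (sup_pay_ge0 p i)) _.
  apply: (range_sup_le pi0) => pi; apply: ler_sum => k _.
  rewrite ler_wpM2l ?fdist_ge0//; apply: le_trans (reward_le_opening _ _ _ _) _.
  by rewrite ffunE; apply: le_fdist_mean.
have muP k : exists g : fdist R A,
    forall a, g a = \sum_(f : {ffun K -> A} | f k == a) l f.
  apply: fdist_of => [a|]; first by apply: sumr_ge0 => f _; exact: fdist_ge0.
  rewrite -(fdist_sum1 l).
  by rewrite [RHS](partition_big (fun f : {ffun K -> A} => f k) xpredT).
have [mu muE] := choice muP; exists mu => sg.
apply: le_trans (lP sg) _; rewrite /F.
under eq_bigr do rewrite mulr_sumr.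
rewrite exchange_big/=; apply: ler_sum => k _.
under eq_bigr do rewrite mulrCA.
rewrite -mulr_sumr ler_wpM2l ?fdist_ge0//.
rewrite (partition_big (fun f : {ffun K -> A} => f k) xpredT)//=.
apply: ler_sum => a _; rewrite muE mulr_suml.
by apply: ler_sum => f /eqP->.
Qed.

(** As [mu] is fixed before player 2 chooses a policy, player 2 can compute the posterior too, and
    may open with [nu] and go on nearly optimally from there. *)
Lemma upper_subsolution p i : exists mu : K -> fdist R A,
  forall nu, upper p i <= bellman upper p i mu nu.
Proof.
have [mu muP] := upper_le_opening p i; exists mu => nu.
apply/ler_addgt0Pr => e e0.
pose post a := posterior p0 mu a p.
have opt p' j : exists sg, range_sup (pay p' j ^~ sg) <= upper p' j + e.
  exact: (range_inf_approx sg0 (sup_pay_ge0 p' j)).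
have [c cP] := choice (fun x => opt x.1 x.2).
pose sg := glue (fun=> nu) (fun x j => c (post x.1.2, j)).
apply: le_trans (muP sg) _.
rewrite /opening one_stage_posterior.
apply: (@le_trans _ _ (bellman upper p i mu nu + beta * e)); last first.
  by rewrite lerD2l ger_pMl// ltW.
apply: one_stage_le; first exact: ltW.
(* The posterior average of [best] is at most what player 1 can obtain in the continuation game,
   which [c] keeps within [e] of [upper]. *)
move=> a b j; apply: le_trans (sum_best_le _ _ _) _.
rewrite (_ : pay _ _ ^~ _ = pay (post a) j ^~ (c (post a, j))).
  exact: (cP (post a, j)).
apply/funext => pi; apply: pay_agree => // k; exact: drop_move_glue.
Qed.

(** A subsolution and a supersolution of the same contraction are compared: their largest gap [d]
    satisfies [d <= beta * d]. *)
Lemma upper_le_lower p i : upper p i <= lower p i.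
Proof.
pose gap (x : fdist R K * S) := upper x.1 x.2 - lower x.1 x.2.
have gapM x : gap x <= M.
  have /andP[_ h] := upper_bounds x.1 x.2.
  by have /andP[h' _] := lower_bounds x.1 x.2; rewrite /gap; lra.
pose d := range_sup gap.
have gap_d x : gap x <= d by exact: (range_sup_ub x gapM).
(* Nonnegativity allows [one_stage_le] to be applied with error [d]. *)
have d0 : 0 <= d.
  by apply: le_trans (gap_d (p, i)); rewrite subr_ge0 lower_le_upper.
suff : d <= beta * d.
  move=> dd; have : d <= 0.
    rewrite leNgt; apply/negP => d_gt0.
    have : 0 < (1 - beta) * d by rewrite mulr_gt0// subr_gt0.
    by lra.
  by move=> d_le0; have := gap_d (p, i); rewrite /gap/=; lra.
apply: (range_sup_le (p, i)) => -[p' i']; rewrite /gap/= lerBlDl.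
have [mu muP] := upper_subsolution p' i'.
rewrite -lerBlDr.
apply: le_trans (lower_supersolution p' i' mu).
apply: (le_range_inf fB) => nu; rewrite lerBlDr.
apply: le_trans (muP nu) _; apply: one_stage_le => // a b j.
by rewrite -lerBlDl; exact: (gap_d (_, _)).
Qed.

Lemma lower_eq_upper : lower = upper.
Proof.
apply/funext => p; apply/funext => i.
by apply/eqP; rewrite eq_le lower_le_upper upper_le_lower.
Qed.

Lemma ereal_lower_value p i : ereal_sup (range (fun pi =>
  ereal_inf (range (fun sg => (pay p i pi sg)%:E)))) = (lower p i)%:E.
Proof.
under eq_fun => pi do rewrite (ereal_inf_range sg0 (pay_ge0 p i pi)).
exact: (ereal_sup_range pi0 (inf_pay_leM p i)).
Qed.

Lemma ereal_upper_value p i : ereal_inf (range (fun sg =>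
  ereal_sup (range (fun pi => (pay p i pi sg)%:E)))) = (lower p i)%:E.
Proof.
rewrite lower_eq_upper.
under eq_fun => sg do
  rewrite (ereal_sup_range (f := pay p i ^~ sg) pi0 (pay_le p i ^~ sg)).
exact: (ereal_inf_range sg0 (sup_pay_ge0 p i)).
Qed.

Lemma bellman_lower p i :
  ereal_inf (range (fun nu => ereal_sup (range (fun mu =>
    (bellman lower p i mu nu)%:E)))) = (lower p i)%:E /\
  ereal_sup (range (fun mu => ereal_inf (range (fun nu =>
    (bellman lower p i mu nu)%:E)))) = (lower p i)%:E.
Proof.
have bd0 mu nu : 0 <= bellman lower p i mu nu.
  by have /andP[] := bellman_bounds p i mu nu lower_bounds.
have bdM mu nu : bellman lower p i mu nu <= M.
  by have /andP[] := bellman_bounds p i mu nu lower_bounds.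
have inf_le mu nu : range_inf (bellman lower p i mu) <= bellman lower p i mu nu.
  exact: (range_inf_lb nu (bd0 mu)).
have le_sup mu nu :
    bellman lower p i mu nu <= range_sup (bellman lower p i ^~ nu).
  exact: (range_sup_ub (f := bellman lower p i ^~ nu) mu (bdM ^~ nu)).
have inf_leM mu : range_inf (bellman lower p i mu) <= M.
  exact: le_trans (inf_le mu fB) (bdM _ _).
have sup_ge0 nu : 0 <= range_sup (bellman lower p i ^~ nu).
  exact: le_trans (bd0 (fun=> fA) nu) (le_sup _ _).
under eq_fun => nu do
  rewrite (ereal_sup_range (f := bellman lower p i ^~ nu) (fun=> fA)
    (bdM ^~ nu)).
rewrite (ereal_inf_range fB sup_ge0).
under [in X in _ /\ X]eq_fun => mu do rewrite (ereal_inf_range fB (bd0 mu)).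
rewrite (ereal_sup_range (fun=> fA) inf_leM).
(* Here [x] is the inf sup and [y] the sup inf. The chain [lower p i <= y <= x <= lower p i] closes
   up because [lower] and [upper] agree. *)
set x := range_inf _; set y := range_sup _.
have yx : y <= x.
  apply: (le_range_inf fB) => nu; apply: (range_sup_le (fun=> fA)) => mu.
  exact: le_trans (inf_le mu nu) (le_sup mu nu).
have xl : x <= lower p i.
  rewrite [leRHS](congr1 (fun f => f p i) lower_eq_upper).
  exact: upper_ge_bellman_lower.
have ly : lower p i <= y.
  have [mu muP] := upper_subsolution p i.
  apply: (@le_trans _ _ (range_inf (bellman lower p i mu))).
    by apply: (le_range_inf fB) => nu; rewrite lower_eq_upper; exact: muP.
  exact: (range_sup_ub mu inf_leM).
split; congr EFin; apply/eqP; rewrite eq_le.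
- by rewrite xl (le_trans ly yx).
- by rewrite ly (le_trans yx xl).
Qed.

End discrete_game.

(** * Stieltjes measures and independence *)

Section stieltjes.
Variables (R : realType) (f : cumulative R R).
Local Notation LS := (lebesgue_stieltjes_measure f).

Lemma stieltjes_itvoc (a b : R) : a <= b -> LS `]a, b] = (f b - f a)%:E.
Proof.
move=> ab; rewrite /lebesgue_stieltjes_measure /measure_extension/=.
by rewrite measurable_mu_extE/= ?wlength_itv_bnd//; exact: is_ocitv.
Qed.

Lemma stieltjes_itvoy (a l : R) : f t @[t --> +oo] --> l ->
  LS `]a, +oo[ = (l - f a)%:E.
Proof.
move=> fl.
have h1 : LS `]a, (a + n%:R)] @[n --> \oo] -->
    LS (\bigcup_n `]a, (a + n%:R)]%classic).
  apply: nondecreasing_cvg_mu => //; first exact: bigcup_measurable.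
  move=> m n mn; apply/subsetPset; apply: subset_itvl.
  by rewrite bnd_simp lerD2l ler_nat.
rewrite itv_bndy_bigcup_BRight.
apply: (cvg_unique _ h1) => //.
rewrite (_ : (fun n => _) = (fun n => (f (a + n%:R) - f a)%:E)); last first.
  by apply/funext => n; rewrite stieltjes_itvoc// lerDl.
apply: cvg_EFin; first by near=> n.
apply: cvgB; last exact: cvg_cst.
apply: (cvg_comp _ f _ fl).
apply/cvgryPge => x; near=> n.
rewrite -lerBlDl; near: n; exact: nbhs_infty_ger.
Unshelve. all: by end_near. Qed.

Hypothesis f0 : forall t, t <= 0 -> f t = 0.

Lemma stieltjes_itvNyc t : LS `]-oo, t] = (f t)%:E.
Proof.
have h1 : LS `](- n%:R), t] @[n --> \oo] -->
    LS (\bigcup_n `](- n%:R), t]%classic).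
  apply: nondecreasing_cvg_mu => //; first exact: bigcup_measurable.
  by move=> *; apply/subsetPset/subset_itv; rewrite leBSide//= lerN2 ler_nat.
rewrite itvNybndEbigcup; apply: (cvg_unique _ h1) => //.
apply: cvg_near_cst; near=> n.
rewrite stieltjes_itvoc; last by rewrite lerNl; near: n; exact: nbhs_infty_ger.
by rewrite (@f0 (- n%:R)) ?subr0// oppr_le0.
Unshelve. all: by end_near. Qed.

Lemma stieltjes_setT l : f t @[t --> +oo] --> l -> LS setT = l%:E.
Proof.
move=> fl.
have -> : LS setT = (LS `]-oo, 0%R] + LS `]0%R, +oo[)%E.
  rewrite -(setUv `]-oo, 0]%classic) setCitvl; apply: measureU => //.
  by rewrite -setCitvl setICr.
rewrite stieltjes_itvNyc (stieltjes_itvoy _ fl) -EFinD.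
by congr EFin; ring.
Qed.

(** The intervals []a, b]] are stable under intersection and exhaust the line by sets of finite
    measure, so agreement on them is enough. The factor [k] allows for unnormalized laws. *)
Lemma stieltjes_unique (m : {measure set (measurableTypeR R) -> \bar R})
    (k : R) : 0 <= k ->
  (forall t : R, m `]-oo, t]%classic = (k * f t)%:E) ->
  forall V, measurable V -> m V = (k%:E * LS V)%E.
Proof.
move=> k0 mE V mV.
pose m2 : {measure set _ -> \bar R} := mscale (NngNum k0) LS.
have moc (a b : R) : a <= b -> m `]a, b]%classic = (k * (f b - f a))%:E.
  move=> ab; have -> : `]a, b]%classic = `]-oo, b] `\` `]-oo, a].
    by rewrite -[RHS]setCK setCD setCitvl setUC -[LHS]setCK setCitv.
  have -> : m (`]-oo, b] `\` `]-oo, a]) =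
      (m `]-oo, b]%classic - m (`]-oo, b] `&` `]-oo, a]))%E.
    by apply: measureD => //; rewrite [ltLHS]mE ltry.
  rewrite setIidr; last exact: subset_itvl.
  by rewrite !mE -EFinB mulrBr.
rewrite (_ : (k%:E * LS V)%E = m2 V)//.
apply: (@measure_unique _ R (measurableTypeR R) (@ocitv R)
  (fun n => `](- n%:R), n%:R]%classic) _ _ _ _ m m2) => //.
- exact: (@measurableI _ (ocitv_type R)).
- by move=> n; exact: is_ocitv.
- apply/seteqP; split => // t _; exists (Num.truncn `|t|).+1 => //=.
  have := truncnS_gt `|t|; rewrite ltr_norml => /andP[ts st].
  by rewrite in_itv/= ts ltW.
- move=> _ [[a b] _ <-] /=; have [ab|ba] := leP a b.
    by rewrite moc//= /mscale/= stieltjes_itvoc.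
  by rewrite set_itv_ge ?measure0// bnd_simp -leNgt ltW.
- move=> n; have : (- n%:R <= n%:R :> R).
    by rewrite lerNl (le_trans _ (ler0n _ _))// oppr_le0.
  by move=> /moc /= ->; rewrite ltry.
Qed.

End stieltjes.

Lemma integral_mrestr d (T : measurableType d) (R : realType)
    (mu : {measure set T -> \bar R}) (D : set T) (mD : measurable D)
    (f : T -> \bar R) : measurable_fun setT f -> (forall x, 0 <= f x)%E ->
  (\int[mrestr mu mD]_x f x = \int[mu]_(x in D) f x)%E.
Proof.
move=> mf f0.
rewrite [LHS](@ge0_negligible_integral _ _ _ _ _ (~` D))//; last first.
- by rewrite /= /mrestr setICl measure0.
- exact: measurableC.
rewrite setTD setCK; apply: eq_measure_integral => A mA AD.
by rewrite /= /mrestr setIidl.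
Qed.

Section restricted_law.
Context d d' (T : measurableType d) (T' : measurableType d') (R : realType).
Variables (P : {finite_measure set T -> \bar R}) (D : set T) (X : T -> T').
Hypotheses (mD : measurable D) (mX : measurable_fun setT X).

(** Without normalization, [P D] may be 0. The measurability proofs are arguments so that a measure
    structure can be attached to the definition. *)
Definition restricted_law of measurable D & measurable_fun setT X :
  set T' -> \bar R := fun U => P (D `&` X @^-1` U).
Local Notation law := (restricted_law mD mX).

Let mpre U : measurable U -> measurable (X @^-1` U).
Proof. by move=> mU; rewrite -[X in measurable X]setTI; exact: mX. Qed.

Let law0 : law set0 = 0%E.
Proof. by rewrite /restricted_law preimage_set0 setI0 measure0. Qed.

Let law_ge0 U : (0 <= law U)%E.
Proof. exact: measure_ge0. Qed.

Let law_sigma_additive : semi_sigma_additive law.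
Proof.
move=> F mF tF mU; rewrite /restricted_law preimage_bigcup setI_bigcupr.
apply: measure_semi_sigma_additive.
- by move=> n; apply: measurableI => //; exact: mpre.
- apply/trivIsetP => /= i j _ _ ij.
  rewrite setIACA -preimage_setI; move/trivIsetP : tF => /(_ _ _ _ _ ij) ->//.
  by rewrite preimage_set0 setI0.
- by apply: bigcup_measurable => n _; apply: measurableI => //; exact: mpre.
Qed.

HB.instance Definition _ :=
  isMeasure.Build _ _ _ law law0 law_ge0 law_sigma_additive.

Let law_fin : fin_num_fun law.
Proof.
move=> U mU; apply: (fin_num_measure P); apply: measurableI => //.
exact: mpre.
Qed.

HB.instance Definition _ := Measure_isFinite.Build _ _ _ law law_fin.

Lemma integral_restricted_law (f : T' -> \bar R) :
  measurable_fun setT f -> (forall x, 0 <= f x)%E ->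
  (\int[law]_x f x = \int[P]_(w in D) f (X w))%E.
Proof.
move=> mf f0.
transitivity (\int[pushforward (mrestr P mD) X]_x f x)%E.
  by congr integral; apply/funext => U; rewrite /pushforward /mrestr setIC.
rewrite ge0_integral_pushforward// preimage_setT integral_mrestr//.
- exact: measurableT_comp.
- by move=> w; exact: f0.
Qed.

End restricted_law.

Section independent_product.
Local Open Scope ereal_scope.
Context d (T : measurableType d) (R : realType) (P : probability T R).
Variables (X Y : T -> R) (D E : set T)
  (nu : {sigma_finite_measure set (measurableTypeR R) -> \bar R}).
Hypotheses (mX : measurable_fun setT X) (mY : measurable_fun setT Y).
Hypotheses (mD : measurable D) (mE : measurable E).
Hypothesis indep : forall U V : set R, measurable U -> measurable V ->
  P (E `&` (X @^-1` U `&` Y @^-1` V)) = P (D `&` X @^-1` U) * nu V.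

Let XY (w : T) : measurableTypeR R * measurableTypeR R := (X w, Y w).

(** By [indep], the law of [(X, Y)] on [E] is the product of the law of [X] on [D] and of [nu];
    Tonelli's theorem then splits the integral. *)
Lemma integral_independent (f g : R -> R) :
  measurable_fun setT f -> measurable_fun setT g ->
  (forall x, 0 <= f x)%R -> (forall x, 0 <= g x)%R ->
  \int[P]_(w in E) (f (X w) * g (Y w))%:E =
  \int[P]_(w in D) (f (X w))%:E * \int[nu]_x (g x)%:E.
Proof.
move=> mf mg f0 g0.
have mXY : measurable_fun setT XY by exact/measurable_fun_pair.
have mX' : measurable_fun setT (X : T -> measurableTypeR R) by [].
pose m1 := restricted_law P mD mX'.
pose m2 := restricted_law P mE mXY.
have prod W : measurable W -> (m1 \x nu) W = m2 W.
  apply: product_measure_unique => U V mU mV; exact: indep.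
pose h (z : measurableTypeR R * measurableTypeR R) := (f z.1 * g z.2)%:E.
have mh : measurable_fun setT h.
  apply/measurable_EFinP/measurable_funM; exact: measurableT_comp.
have h0 z : 0 <= h z by rewrite lee_fin mulr_ge0.
transitivity (\int[m2]_z h z).
  by rewrite integral_restricted_law.
rewrite (eq_measure_integral (m1 \x nu)) => [|W mW _]; last exact/esym/prod.
rewrite fubini_tonelli1// /fubini_F/=.
under eq_integral => x _.
  rewrite /h/=; under eq_integral do rewrite EFinM.
  rewrite ge0_integralZl//; last 3 first.
  - exact/measurable_EFinP.
  - by move=> y _; rewrite lee_fin.
  - by rewrite lee_fin.
over.
set I := \int[nu]_x (g x)%:E.
have I0 : 0 <= I by apply: integral_ge0 => y _; rewrite lee_fin.
rewrite ge0_integralZr//; last 2 first.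
- exact/measurable_EFinP.
- by move=> y _; rewrite lee_fin.
rewrite integral_restricted_law//.
exact/measurable_EFinP.
Qed.

End independent_product.

(** * Discounting a semi-Markov kernel *)

Section discount.
Variables (R : realType) (alpha : R).
Hypothesis alpha0 : 0 < alpha.
Local Notation mu := (@lebesgue_measure R).

Definition disc (t : R) : R := expR (- (alpha * t)).

Lemma disc_ge0 t : 0 <= disc t. Proof. exact: expR_ge0. Qed.

Lemma disc_le1 t : 0 <= t -> disc t <= 1.
Proof. by move=> t0; rewrite -expR0 ler_expR oppr_le0 mulr_ge0// ltW. Qed.

Lemma discD s t : disc (s + t) = disc s * disc t.
Proof. by rewrite /disc -expRD; congr expR; ring. Qed.

Lemma continuous_disc : continuous disc.
Proof.
move=> x; apply: (@continuous_comp _ _ _ (fun t => - (alpha * t)) expR).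
  by apply: cvgN; apply: cvgMr; exact: cvg_id.
exact: continuous_expR.
Qed.

Lemma measurable_disc : measurable_fun setT disc.
Proof. exact: continuous_measurable_fun continuous_disc. Qed.

Lemma integral_disc_oo a :
  (\int[mu]_(s in `[a, +oo[) (disc s)%:E = (disc a / alpha)%:E)%E.
Proof.
pose F s : R := - (alpha^-1 * disc s).
have dF x : is_derive x (1:R) F (disc x).
  have d1 : is_derive x (1:R) (fun t : R => - (alpha * t)) (- alpha).
    rewrite (_ : (fun t => _) = (- alpha) *: (id : R -> R)); last first.
      by apply/funext => t /=; rewrite -mulNr.
    by apply: is_derive_eq; rewrite [LHS]mulr1.
  have -> : F = (- alpha^-1) *: (expR \o (fun t : R => - (alpha * t))).
    by apply/funext => t; rewrite /F -mulNr.
  apply: is_derive_eq.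
  by rewrite [LHS]mulrCA mulrNN mulVf ?gt_eqF// mulr1.
have cF : continuous F.
  by move=> x; apply: cvgN; apply: cvgMr; exact: continuous_disc.
rewrite (@ge0_continuous_FTC2y _ disc F _ 0).
- by rewrite -EFinB sub0r opprK mulrC.
- by move=> x _; exact: disc_ge0.
- by apply: continuous_subspaceT; exact: continuous_disc.
- rewrite -oppr0 -(mulr0 alpha^-1); apply: cvgN; apply: cvgMr.
  apply: (@cvg_comp _ _ _ (fun z => alpha * z) (fun z => expR (- z))
    _ (pinfty_nbhs R)); last exact: cvgr_expR.
  exact: gt0_cvgMry.
- by move=> x _; exact: ex_derive.
- by apply: cvg_at_right_filter; exact: cF.
- by move=> x _; rewrite derive1E; exact: derive_val.
Qed.

Lemma integral_disc_itv a b : a <= b ->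
  (\int[mu]_(s in `[a, b[) (disc s)%:E = ((disc a - disc b) / alpha)%:E)%E.
Proof.
move=> ab.
(* Cancellation in the extended reals, legitimate because the cancelled term is finite. *)
have addK (X : \bar R) (x y : R) : (X + x%:E = y%:E)%E -> X = (y - x)%:E.
  by case: X => [z| |]//=; rewrite -EFinD => -[<-]; rewrite addrK.
have := integral_disc_oo a.
rewrite (@itv_bndbnd_setU _ _ _ (BLeft b)); last 2 first.
- by rewrite bnd_simp.
- by rewrite bnd_simp.
rewrite ge0_integral_setU//; last 3 first.
- by apply/measurable_EFinP; apply: measurable_funTS; exact: measurable_disc.
- by move=> x _; rewrite lee_fin; exact: disc_ge0.
- apply/disj_setPS => x [] /=; rewrite !in_itv/= andbT => /andP[_ xb] bx.
  by have := le_lt_trans bx xb; rewrite ltxx.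
rewrite [in X in (_ + X)%E]integral_disc_oo.
by rewrite mulrBl => /addK.
Qed.

End discount.

Section kernel.
Variables (R : realType) (S A B : finPointedType).
Variables (Q : kernel_on R S A B) (alpha : R).
Hypotheses (kerQ : semi_markov_kernel Q) (alpha0 : 0 < alpha).
Local Notation disc := (disc alpha).

Local Notation LS i a b j := (lebesgue_stieltjes_measure (Q i a b j)).

Lemma kernel_nneg i a b j t : 0 <= Q i a b j t.
Proof.
have [/(kernel_ge0 kerQ)//|t0] := leP 0 t.
by rewrite (kernel_neg kerQ).
Qed.

Lemma kernel_npos0 i a b j t : t <= 0 -> Q i a b j t = 0.
Proof.
rewrite le_eqVlt => /orP[/eqP->|]; first exact: (kernel_zero kerQ).
exact: (kernel_neg kerQ).
Qed.

Lemma kernel_bounded i a b j t : Q i a b j t <= 1.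
Proof.
have [/(kernel_le1 kerQ i a b)|t0] := leP 0 t; last first.
  by rewrite (kernel_neg kerQ).
apply: le_trans; rewrite /sojourn_cdf (bigD1 j)//= lerDl.
by apply: sumr_ge0 => j' _; exact: kernel_nneg.
Qed.

Definition kernel_mass i a b j : R := lim (Q i a b j t @[t --> +oo]).

Lemma kernel_cvg i a b j : Q i a b j t @[t --> +oo] --> kernel_mass i a b j.
Proof.
apply/cvg_ex; eexists; apply: nondecreasing_cvgr.
  by move=> x y xy; exact: cumulative_is_nondecreasing.
by exists 1 => _ [t _ <-]; exact: kernel_bounded.
Qed.

Lemma kernel_mass_sum1 i a b : \sum_j kernel_mass i a b j = 1.
Proof. exact: kernel_lim1. Qed.

Lemma kernel_le_mass i a b j t : Q i a b j t <= kernel_mass i a b j.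
Proof.
apply: limr_ge; first exact: (cvgP _ (@kernel_cvg i a b j)).
near=> x; apply: (cumulative_is_nondecreasing (Q i a b j)).
near: x; apply: nbhs_pinfty_ge; exact: num_real.
Unshelve. all: by end_near. Qed.

Lemma kernel_setT i a b j : LS i a b j setT = (kernel_mass i a b j)%:E.
Proof.
exact: (stieltjes_setT (fun t => @kernel_npos0 i a b j t)
  (@kernel_cvg i a b j)).
Qed.

Lemma kernel_Nyc i a b j t : LS i a b j `]-oo, t] = (Q i a b j t)%:E.
Proof. exact: (stieltjes_itvNyc (fun t => @kernel_npos0 i a b j t)). Qed.

Lemma kernel_integral_setT i a b j (f : R -> \bar R) :
  measurable_fun setT f -> (forall t, 0 <= f t)%E ->
  (\int[LS i a b j]_t f t = \int[LS i a b j]_(t in `[0%R, +oo[) f t)%E.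
Proof.
move=> mf f0.
rewrite [LHS](@ge0_negligible_integral _ (measurableTypeR R) _ _ _
  `]-oo, (0:R)[%classic)//.
  by rewrite setTD setCitvl.
apply/eqP; rewrite eq_le measure_ge0 andbT.
rewrite -[leRHS](_ : LS i a b j `]-oo, 0] = 0%E); last first.
  by rewrite kernel_Nyc kernel_npos0.
by apply: le_measure; rewrite ?inE//; apply: subset_itvl; rewrite bnd_simp.
Qed.

(** Splitting at [d], the discount is at most 1 before and at most [disc d] after. The case [d = 0]
    also gives finiteness. *)
Lemma integral_disc_kernel_le i a b j (d : R) : 0 <= d ->
  (\int[LS i a b j]_(t in `[0%R, +oo[) (disc t)%:E <=
   (Q i a b j d + disc d * (kernel_mass i a b j - Q i a b j d))%:E)%E.
Proof.
move=> d0.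
have mdisc D : measurable_fun D (fun t : measurableTypeR R => (disc t)%:E).
  apply/measurable_EFinP; apply: measurable_funTS; exact: measurable_disc.
have disc0 t : (0 <= (disc t)%:E)%E by rewrite lee_fin; exact: disc_ge0.
rewrite (@itv_bndbnd_setU _ _ _ (BRight d)); last 2 first.
- by rewrite bnd_simp.
- by rewrite bnd_simp.
rewrite ge0_integral_setU//; last first.
  apply/disj_setPS => x [] /=; rewrite !in_itv/= andbT => /andP[_ xb] bx.
  by have := le_lt_trans xb bx; rewrite ltxx.
rewrite EFinD; apply: leeD.
- apply: (@le_trans _ _ (\int[LS i a b j]_(t in `[0%R, d]) cst 1%E t)%E).
    apply: ge0_le_integral => // t /=; rewrite in_itv/= => /andP[t0 _].
    by rewrite lee_fin disc_le1.
  rewrite integral_cst// mul1e -kernel_Nyc.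
  apply: le_measure; rewrite ?inE//; exact: subset_itvr.
- apply: (@le_trans _ _
     (\int[LS i a b j]_(t in `]d, +oo[) cst (disc d)%:E t)%E).
    apply: ge0_le_integral => // t /=; rewrite in_itv/= andbT => dt.
    by rewrite lee_fin ler_expR lerN2 ler_wpM2l// ltW.
  rewrite integral_cst// EFinM.
  by rewrite -(stieltjes_itvoy d (@kernel_cvg i a b j)).
Qed.

Lemma discounted_transitionE i a b j :
  (\int[LS i a b j]_t (disc t)%:E =
   (discounted_transition Q alpha i a b j)%:E)%E.
Proof.
rewrite kernel_integral_setT; last 2 first.
- by apply/measurable_EFinP; exact: measurable_disc.
- by move=> t; rewrite lee_fin; exact: disc_ge0.
rewrite /discounted_transition /Rintegral fineK//.
rewrite ge0_fin_numE; last first.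
  by apply: integral_ge0 => t _; rewrite lee_fin; exact: disc_ge0.
exact: le_lt_trans (integral_disc_kernel_le i a b j (lexx 0)) (ltry _).
Qed.

Lemma discounted_transition_ge0 i a b j :
  0 <= discounted_transition Q alpha i a b j.
Proof.
apply: fine_ge0; apply: integral_ge0 => t _.
by rewrite lee_fin; exact: disc_ge0.
Qed.

(** Sojourns longer than [d] have probability at least [e] and are discounted to at most [disc d],
    which takes at least [e * (1 - disc d)] off the total mass 1. *)
Lemma discounted_transition_sum_le i a b (d e : R) : 0 <= d ->
  sojourn_cdf Q i a b d <= 1 - e ->
  \sum_j discounted_transition Q alpha i a b j <= 1 - e * (1 - disc d).
Proof.
move=> d0 De.
have disc1 : disc d <= 1 by exact: disc_le1.
apply: (@le_trans _ _ (\sum_j (Q i a b j d +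
    disc d * (kernel_mass i a b j - Q i a b j d)))).
  apply: ler_sum => j _; rewrite -lee_fin -discounted_transitionE.
  rewrite kernel_integral_setT; last 2 first.
  - by apply/measurable_EFinP; exact: measurable_disc.
  - by move=> t; rewrite lee_fin; exact: disc_ge0.
  exact: integral_disc_kernel_le.
rewrite big_split/= -mulr_sumr sumrB kernel_mass_sum1 -/(sojourn_cdf Q i a b d).
nra.
Qed.

(* The maximum only serves to make the function nonnegative on the whole
   line. *)
Definition discounted_length (t : R) : R := (1 - disc (Num.max 0 t)) / alpha.

Lemma discounted_length_ge0 t : 0 <= discounted_length t.
Proof.
apply: divr_ge0; last exact: ltW.
by rewrite subr_ge0 disc_le1// le_max lexx.
Qed.

Lemma measurable_discounted_length : measurable_fun setT discounted_length.
Proof.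
apply: measurable_funM => //; apply: measurable_funB => //.
apply: measurableT_comp; first exact: measurable_disc.
exact: measurable_maxr.
Qed.

Local Notation mu := (@lebesgue_measure R).

(** The discounted indicator of [0 <= s < t] at [(t, s)]. Integrating out [s] gives the discounted
    length of a sojourn [t], integrating out [t] gives the discounted tail of the kernel, and
    Tonelli's theorem equates the two. *)
Let strip (z : measurableTypeR R * measurableTypeR R) : \bar R :=
  (if (0 <= z.2) && (z.2 < z.1) then disc z.2 else 0)%:E.

Let measurable_strip : measurable_fun setT strip.
Proof.
apply/measurable_EFinP; apply: measurable_fun_ifT => //.
- apply: measurable_and.
  + exact: measurable_fun_ler.
  + exact: measurable_fun_ltr.
- by apply: measurableT_comp => //; exact: measurable_disc.
Qed.

Let strip_ge0 z : (0 <= strip z)%E.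
Proof. by rewrite lee_fin; case: ifP => // _; exact: disc_ge0. Qed.

Let integral_strip_length t :
  (\int[mu]_s strip (t, s) = (discounted_length t)%:E)%E.
Proof.
transitivity (\int[mu]_(s in `[0%R, t[) (disc s)%:E)%E.
  rewrite [RHS]integral_mkcond; apply: eq_integral => s _.
  rewrite /strip/= patchE; case: ifPn => [st|st].
    by rewrite ifT// inE/= in_itv.
  by rewrite ifF//; apply/negbTE; rewrite notin_setE/= in_itv/=; exact/negP.
rewrite /discounted_length; have [t0|t0] := leP 0 t.
  rewrite integral_disc_itv//; congr (_ / _)%:E.
  by rewrite (_ : disc 0 = 1)// /disc mulr0 oppr0 expR0.
rewrite set_itv_ge ?integral_set0; last by rewrite bnd_simp -leNgt ltW.
by rewrite /disc mulr0 oppr0 expR0 subrr mul0r.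
Qed.

Let integral_strip_kernel i a b j s :
  (\int[LS i a b j]_t strip (t, s) =
   (if 0 <= s then disc s * (kernel_mass i a b j - Q i a b j s) else 0)%:E)%E.
Proof.
case: ifPn => s0; last first.
  by rewrite integral0_eq// => t _; rewrite /strip/= (negbTE s0).
transitivity (\int[LS i a b j]_(t in `]s, +oo[) (cst (disc s)%:E t))%E.
  rewrite [RHS]integral_mkcond; apply: eq_integral => t _.
  rewrite /strip/= patchE s0/=; case: ifPn => st.
    by rewrite ifT// inE/= in_itv/= andbT.
  rewrite ifF//; apply/negbTE; rewrite notin_setE/= in_itv/= andbT.
  exact/negP.
rewrite integral_cst// EFinM.
by rewrite -(stieltjes_itvoy s (@kernel_cvg i a b j)).
Qed.

Lemma integral_discounted_length i a b j :
  (\int[LS i a b j]_t (discounted_length t)%:E =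
   \int[mu]_(s in `[0%R, +oo[)
     (disc s * (kernel_mass i a b j - Q i a b j s))%:E)%E.
Proof.
under eq_integral do rewrite -integral_strip_length.
rewrite (@fubini_tonelli _ _ _ _ _ (LS i a b j) mu strip)//.
rewrite [RHS]integral_mkcond; apply: eq_integral => s _.
rewrite integral_strip_kernel patchE.
case: ifPn => s0; first by rewrite ifT// inE/= in_itv/= andbT.
by rewrite ifF//; apply/negbTE; rewrite notin_setE/= in_itv/= andbT; exact/negP.
Qed.

(** Summed over [j], the tails of the kernel become 1 minus the sojourn distribution function. *)
Lemma mean_discountE i a b :
  (\sum_j \int[LS i a b j]_t (discounted_length t)%:E =
   (mean_discount Q alpha i a b)%:E)%E.
Proof.
(* A discounted length never exceeds [alpha^-1]; this finiteness allows the passage to [fine]. *)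
have h j : (\int[LS i a b j]_t (discounted_length t)%:E <=
    (alpha^-1 * kernel_mass i a b j)%:E)%E.
  apply: (@le_trans _ _ (\int[LS i a b j]_t cst alpha^-1%:E t)%E).
    apply: ge0_le_integral => //.
    - by move=> t _; rewrite lee_fin; exact: discounted_length_ge0.
    - by apply/measurable_EFinP; exact: measurable_discounted_length.
    - move=> t _; rewrite lee_fin -[leRHS]mul1r ler_pM2r ?invr_gt0//.
      by rewrite lerBlDr lerDl disc_ge0.
  by rewrite integral_cst// EFinM -(kernel_setT i a b j).
have fin : (\sum_j \int[LS i a b j]_t (discounted_length t)%:E)%E
    \is a fin_num.
  apply/sum_fin_numP => j _ _; rewrite ge0_fin_numE.
    exact: le_lt_trans (h j) (ltry _).
  by apply: integral_ge0 => t _; rewrite lee_fin; exact: discounted_length_ge0.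
rewrite -(fineK fin) /mean_discount /Rintegral; congr (fine _)%:E.
under eq_bigr do rewrite integral_discounted_length.
rewrite -ge0_integral_sum//.
- apply: eq_integral => s _; rewrite sumEFin -mulr_sumr; congr (_ * _)%:E.
  by rewrite sumrB kernel_mass_sum1.
- move=> j; apply/measurable_EFinP; apply: measurable_funM.
    by apply: measurable_funTS; exact: measurable_disc.
  apply: measurable_funB => //; apply: nondecreasing_measurable => //.
  by move=> x y xy; exact: cumulative_is_nondecreasing.
- move=> j s _; rewrite lee_fin mulr_ge0 ?disc_ge0// subr_ge0.
  exact: kernel_le_mass.
Qed.

Lemma mean_discount_ge0 i a b : 0 <= mean_discount Q alpha i a b.
Proof.
rewrite -lee_fin -mean_discountE; apply: sume_ge0 => j _.
by apply: integral_ge0 => t _; rewrite lee_fin; exact: discounted_length_ge0.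
Qed.

End kernel.

(** * Plays and the payoff *)

Section stage_mean.
Variables (R : realType) (K S A B : finPointedType).
Variables (r : K -> S -> A -> B -> R) (q : S -> A -> B -> S -> R).
Implicit Types (tau : seq_policy R S A B A) (sg : seq_policy R S A B B).

(** The mean of [g] over histories of length [n], with the discounting carried by [q]. *)
Fixpoint stage_mean (n : nat) (g : seq (S * A * B) -> S -> R) (i : S)
    tau sg : R :=
  if n is m.+1 then
    \sum_a \sum_b \sum_j tau [::] i a * sg [::] i b * q i a b j *
      stage_mean m (fun s => g ((i, a, b) :: s)) j
        (drop_move (i, a, b) tau) (drop_move (i, a, b) sg)
  else g [::] i.

(* [stage_mean] unfolds a play from its first move, the game law from its last
   one. *)
Lemma stage_meanS n g i tau sg : stage_mean n.+1 g i tau sg =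
  stage_mean n (fun s i' => \sum_a \sum_b \sum_j
    tau s i' a * sg s i' b * q i' a b j * g (rcons s (i', a, b)) j) i tau sg.
Proof.
elim: n g i tau sg => [//|n IH] g i tau sg.
rewrite [RHS]/=; apply: eq_bigr => a _; apply: eq_bigr => b _.
apply: eq_bigr => j _; congr *%R.
exact: (IH (fun s => g ((i, a, b) :: s)) j
  (drop_move (i, a, b) tau) (drop_move (i, a, b) sg)).
Qed.

(** Rewards collected by recursion on the first move are regrouped by the stage at which they are
    earned. *)
Lemma stage_reward_mean N k i tau sg : stage_reward r q N k i tau sg =
  \sum_(n < N) stage_mean n (fun s i' => \sum_a \sum_b
    tau s i' a * sg s i' b * r k i' a b) i tau sg.
Proof.
elim: N i tau sg => [|N IH] i tau sg; first by rewrite big_ord0.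
rewrite big_ord_recl /= [X in _ = _ + X]exchange_big/= -big_split/=.
apply: eq_bigr => a _; rewrite [X in _ = _ + X]exchange_big/= -big_split/=.
rewrite mulr_sumr; apply: eq_bigr => b _.
rewrite [X in _ = _ + X]exchange_big/= mulrA mulrDr; congr +%R.
rewrite mulr_sumr; apply: eq_bigr => j _.
by rewrite IH !mulr_sumr; apply: eq_bigr => n _; rewrite mulrA.
Qed.

End stage_mean.

Section policies.
Variables (R : realType) (S A B : finPointedType) (E : finType).

Definition seq_of_policy (tau : forall n, history S A B n -> fdist R E) :
  seq_policy R S A B E := fun s i => tau (size s) (in_tuple s, i).

Definition policy_of_seq (tau : seq_policy R S A B E) :
  forall n, history S A B n -> fdist R E := fun n h => tau h.1 h.2.

Lemma seq_of_policyE tau n (h : n.-tuple (S * A * B)) i :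
  seq_of_policy tau h i = tau n (h, i).
Proof.
(* [in_tuple] yields a tuple of length [size s]; once [n] is replaced by that length, both histories
   have the same type. *)
case: h => s /= sn; move: (sn); rewrite -(eqP sn) => sn'.
by rewrite /seq_of_policy; congr (tau _ (_, _)); exact: val_inj.
Qed.

End policies.

Lemma g_sigma_algebraI (T : pointedType) (G : set (set T)) (C D : set T) :
  <<s G >> C -> <<s G >> D -> <<s G >> (C `&` D).
Proof. exact: (@measurableI _ (g_sigma_algebraType G)). Qed.

(** * Measurable events of plays *)

Section plays.
Variables (R : realType) (K S A B : finPointedType).
Local Notation Omega := (Omega R K S A B).
Implicit Types (w : play R K S A B) (n : nat).

Lemma measurable_coordinate (C : set Omega) :
  @coordinate_events R K S A B C -> measurable C.
Proof. exact: sub_sigma_algebra. Qed.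

Lemma measurable_gtype k : measurable ([set w | gtype w = k] : set Omega).
Proof. by apply: measurable_coordinate; left; exists k. Qed.

Lemma measurable_state n i : measurable ([set w | state w n = i] : set Omega).
Proof.
by apply: measurable_coordinate; right; exists n; apply: Or41; exists i.
Qed.

Lemma measurable_action1 n a :
  measurable ([set w | action1 w n = a] : set Omega).
Proof.
by apply: measurable_coordinate; right; exists n; apply: Or42; exists a.
Qed.

Lemma measurable_action2 n b :
  measurable ([set w | action2 w n = b] : set Omega).
Proof.
by apply: measurable_coordinate; right; exists n; apply: Or43; exists b.
Qed.

Lemma measurable_sojourn n :
  measurable_fun setT (fun w : Omega => sojourn w n).
Proof.
move=> _ U mU; rewrite setTI; apply: measurable_coordinate; right; exists n.
by apply: Or44; exists U.
Qed.

Lemma measurable_jump_time n :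
  measurable_fun setT (fun w : Omega => jump_time w n).
Proof.
rewrite (_ : (fun w => _) = (fun w : Omega => \sum_(m < n) sojourn w m)).
  by apply: measurable_sum => m; exact: measurable_sojourn.
by apply/funext => w; rewrite /jump_time big_mkord.
Qed.

Lemma sojourn_ge0 w n : 0 <= sojourn w n.
Proof. by rewrite /sojourn. Qed.

Lemma jump_timeS w n : jump_time w n.+1 = jump_time w n + sojourn w n.
Proof. by rewrite /jump_time big_nat_recr. Qed.

Lemma jump_time_ge0 w n : 0 <= jump_time w n.
Proof. by apply: sumr_ge0 => m _; exact: sojourn_ge0. Qed.

Lemma jump_time_nd w : nondecreasing_seq (jump_time w).
Proof.
by apply/nondecreasing_seqP => n; rewrite jump_timeS lerDl sojourn_ge0.
Qed.

Lemma hist_val n w : tval (hist n w).1 = mkseq (fun m => (w.2 m).1) n.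
Proof.
by rewrite /= /mkseq -val_enum_ord -map_comp.
Qed.

Lemma histS n w (h : n.-tuple (S * A * B)) x j :
  hist n.+1 w = ([tuple of rcons h x], j) <->
  [/\ hist n w = (h, x.1.1), action1 w n = x.1.2, action2 w n = x.2 &
      state w n.+1 = j].
Proof.
have E : (w.2 n).1 = (state w n, action1 w n, action2 w n).
  by rewrite /state /action1 /action2; case: (w.2 n).1 => [[]].
split=> [H|[H Ha Hb <-]].
- have := congr1 (fun z => tval z.1) H; rewrite hist_val mkseqS /=.
  move=> /rcons_inj[hE xE].
  have Hj := congr1 snd H; rewrite /= in Hj.
  rewrite -xE E /=; split=> //.
  by congr (_, _); apply: val_inj; rewrite /= -hE -hist_val.
- congr (_, _); apply: val_inj.
  rewrite -[LHS]/(tval (hist n.+1 w).1) hist_val mkseqS /=.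
  rewrite -(hist_val n w) H /= E Ha Hb.
  have := congr1 snd H => /= ->.
  by case: x {H Ha Hb} => [[]].
Qed.

Lemma measurable_hist n h : measurable ([set w | hist n w = h] : set Omega).
Proof.
case: h => h j.
rewrite (_ : [set w | _] = (\bigcap_(m in [set: 'I_n])
   ([set w | state w m = (tnth h m).1.1] `&`
    [set w | action1 w m = (tnth h m).1.2] `&`
    [set w | action2 w m = (tnth h m).2])) `&`
   [set w | state w n = j]); last first.
  apply/seteqP; split=> [w [<- <-]|w [hw <-]]/=.
    by split=> // m _; rewrite tnth_mktuple.
  congr (_, _); apply: eq_from_tnth => m; rewrite tnth_mktuple.
  have [[]] := hw m Logic.I; rewrite /= /state /action1 /action2.
  by case: (w.2 m).1 (tnth h m) => [[? ?] ?] [[? ?] ?] /= -> -> ->.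
apply: measurableI; last exact: measurable_state.
apply: fin_bigcap_measurable; first exact: finite_finset.
move=> m _; apply: measurableI; last exact: measurable_action2.
by apply: measurableI; [exact: measurable_state|exact: measurable_action1].
Qed.

(** For each [n] these events form a finite partition of the sample space, which [after] refines by
    the actions of stage [n] and [landing] by the next state. *)
Definition before n k (h : history S A B n) : set Omega :=
  [set w | gtype w = k] `&` [set w | hist n w = h].

Definition after n k (h : history S A B n) a b : set Omega :=
  before k h `&` [set w | action1 w n = a /\ action2 w n = b].

Definition landing n k (h : history S A B n) a b j : set Omega :=
  after k h a b `&` [set w | state w n.+1 = j].

Lemma measurable_before n k (h : history S A B n) : measurable (before k h).
Proof.
by apply: measurableI; [exact: measurable_gtype|exact: measurable_hist].
Qed.

Lemma measurable_after n k (h : history S A B n) a b :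
  measurable (after k h a b).
Proof.
apply: measurableI; first exact: measurable_before.
by apply: measurableI; [exact: measurable_action1|exact: measurable_action2].
Qed.

Lemma measurable_landing n k (h : history S A B n) a b j :
  measurable (landing k h a b j).
Proof.
by apply: measurableI; [exact: measurable_after|exact: measurable_state].
Qed.

Lemma before_rcons n k (h : n.-tuple (S * A * B)) i a b j :
  before (n := n.+1) k ([tuple of rcons h (i, a, b)], j) =
  landing (n := n) k (h, i) a b j.
Proof.
apply/seteqP; split=> [w [wk /histS[/= hw wa wb wj]]|w [[[wk hw] [wa wb]] wj]].
  by [].
by split=> //; apply/histS.
Qed.

Lemma sigma_before_before n k (h : history S A B n) (U : set R) :
  measurable U ->
  @sigma_before R K S A B n (before k h `&` [set w | U (jump_time w n)]).
Proof.
move=> mU; apply: g_sigma_algebraI.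
  apply: g_sigma_algebraI; apply: sub_gen_smallest.
    by apply: Or31; exists k.
  by apply: Or32; exists h.
by apply: sub_gen_smallest; apply: Or33; exists U.
Qed.

Lemma sigma_after_after n k (h : history S A B n) a b (U : set R) :
  measurable U ->
  @sigma_after R K S A B n (after k h a b `&` [set w | U (jump_time w n)]).
Proof.
move=> mU; rewrite /after setIAC.
apply: g_sigma_algebraI.
  by apply: sub_gen_smallest; left; exact: sigma_before_before.
apply: (@g_sigma_algebraI _ _ [set w | action1 w n = a]
  [set w | action2 w n = b]);
  apply: sub_gen_smallest; right; [left|right].
  by exists a.
by exists b.
Qed.

End plays.

Lemma integral_fibers d (T : measurableType d) (R : realType) (Z : finType)
    (mu : {measure set T -> \bar R}) (X : T -> Z) (f : T -> \bar R) :
  (forall z, measurable [set w | X w = z]) ->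
  measurable_fun setT f -> (forall w, 0 <= f w)%E ->
  (\int[mu]_w f w = \sum_z \int[mu]_(w in [set w | X w = z]) f w)%E.
Proof.
move=> mX mf f0.
transitivity (\int[mu]_w \sum_z (f \_ [set w | X w = z]) w)%E.
  apply: eq_integral => w _; rewrite (bigD1 (X w))//= patchE mem_set//.
  rewrite big1 ?adde0// => z zX; rewrite patchE memNset//= => Xz.
  by rewrite Xz eqxx in zX.
rewrite ge0_integral_sum//.
- by apply: eq_bigr => z _; rewrite [RHS]integral_mkcond.
- move=> z; apply/(measurable_restrictT f) => //; exact: measurable_funTS.
- by move=> z w _; exact: erestrict_ge0.
Qed.

Lemma bij_rcons_tuple (T : eqType) n :
  bijective (fun z : n.-tuple T * T => [tuple of rcons z.1 z.2]).
Proof.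
pose unrcons (t : n.+1.-tuple T) : n.-tuple T * T :=
  ([tuple of belast (thead t) (behead t)], last (thead t) (behead t)).
have unrconsK t : [tuple of rcons (unrcons t).1 (unrcons t).2] = t.
  by apply: val_inj; rewrite /= -lastI [in RHS](tuple_eta t).
exists unrcons => // -[s x].
have /(congr1 val)/= := unrconsK [tuple of rcons s x].
by move=> /rcons_inj[sE xE]; congr (_, _) => //; exact: val_inj.
Qed.

Lemma sum_triple (R : nmodType) (I J L : finType) (F : I * J * L -> R) :
  \sum_x F x = \sum_i \sum_j \sum_l F (i, j, l).
Proof. by rewrite !pair_bigA; apply: eq_bigr => -[[i j] l]. Qed.

(** * The discounted law of histories *)

Section law.
Variables (R : realType) (K S A B : finPointedType).
Variables (Q : kernel_on R S A B) (c : K -> S -> A -> B -> R) (alpha : R).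
Hypotheses (kerQ : semi_markov_kernel Q) (alpha0 : 0 < alpha).
Hypothesis c0 : forall k i a b, 0 <= c k i a b.
Variables (p : fdist R K) (i0 : S) (pi : policy1 R K S A B)
  (sg : policy2 R S A B) (P : probability (Omega R K S A B) R).
Hypothesis law : is_game_law Q p i0 pi sg P.

Local Notation Omega := (Omega R K S A B).
Local Notation disc := (disc alpha).
Local Notation LS i a b j := (lebesgue_stieltjes_measure (Q i a b j)).
Local Notation q := (discounted_transition Q alpha).
Local Notation m := (mean_discount Q alpha).
Local Notation len := (discounted_length alpha).

Let play_prob k n (h : history S A B n) a b : R := pi k h a * sg h b.

Let play_prob_ge0 k n (h : history S A B n) a b : 0 <= play_prob k h a b.
Proof. by rewrite mulr_ge0 ?fdist_ge0. Qed.

(** On [before k h] the conditional probability of the actions is a constant. *)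
Lemma prob_after n k (h : history S A B n) a b (U : set R) : measurable U ->
  P (after k h a b `&` [set w | U (jump_time w n)]) =
  ((play_prob k h a b)%:E * P (before k h `&` [set w | U (jump_time w n)]))%E.
Proof.
move=> mU.
have [_ /(_ _ (sigma_before_before k h mU))] := law_actions law n a b.
rewrite setIAC => ->.
have mC : measurable (before k h `&` [set w : Omega | U (jump_time w n)]).
  apply: measurableI; first exact: measurable_before.
  by rewrite -[X in measurable X]setTI; exact: measurable_jump_time.
rewrite -integral_cst//; apply: eq_integral => w.
by rewrite inE => -[[/= -> ->] _].
Qed.

(** The kernel prescribes the sojourn law only on half-lines; [stieltjes_unique] extends it to all
    [V], for each event on the elapsed time separately. *)
Lemma prob_landing n k (h : history S A B n) a b j (U V : set R) :
  measurable U -> measurable V ->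
  P (landing k h a b j `&`
     ([set w | U (jump_time w n)] `&` [set w | V (sojourn w n)])) =
  (P (after k h a b `&` [set w | U (jump_time w n)]) * LS h.2 a b j V)%E.
Proof.
move=> mU mV.
set C := after k h a b `&` _.
have mC : measurable (C : set Omega).
  apply: measurableI; first exact: measurable_after.
  by rewrite -[X in measurable X]setTI; exact: measurable_jump_time.
have mCj : measurable (C `&` [set w | state w n.+1 = j] : set Omega).
  by apply: measurableI => //; exact: measurable_state.
have mt : measurable_fun setT
  ((fun w => sojourn w n) : Omega -> measurableTypeR R).
  exact: measurable_sojourn.
have PC : P C = (fine (P C))%:E by rewrite fineK// fin_num_measure.
rewrite PC -(@stieltjes_unique _ (Q h.2 a b j)
  (restricted_law P mCj mt))//.
- rewrite /= /restricted_law; congr (P _).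
  by apply/seteqP; split=> w; rewrite /C /landing /=; tauto.
- by rewrite fine_ge0.
move=> t; rewrite EFinM -PC /= /restricted_law.
(* The law speaks of [0 <= t] only; for negative [t] the event is empty because sojourns are
   nonnegative. *)
have [t0|t0] := ltP t 0.
  rewrite (_ : _ `&` _ = set0) ?measure0 ?(kernel_neg kerQ)// ?mule0//.
  apply/seteqP; split => // w [_] /=; rewrite in_itv/= => wt.
  by have := lt_le_trans t0 (sojourn_ge0 w n); rewrite ltNge wt.
have [_ /(_ C)] := law_transition law n j t0.
rewrite {1}/C => /(_ (sigma_after_after _ _ _ _ mU)).
rewrite -/C => E.
rewrite muleC -integral_cst//.
transitivity (P (C `&` [set w | jump_time w n.+1 - jump_time w n <= t /\
  state w n.+1 = j])).
  congr (P _); rewrite -setIA; congr (_ `&` _); apply/seteqP; split => w /=.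
    by rewrite in_itv/= jump_timeS addrC addKr => -[].
  by rewrite in_itv/= jump_timeS addrC addKr => -[].
rewrite E; apply: eq_integral => w; rewrite inE.
by move=> [[[/= _ hw] [wa wb]] _]; rewrite wa wb -hw.
Qed.

(** The probability of type [k] and history [h], discounted by the time of the last jump in [h]. *)
Definition weight k n (h : history S A B n) : \bar R :=
  (\int[P]_(w in before k h) (disc (jump_time w n))%:E)%E.

Let mjump n : measurable_fun setT ((fun w => jump_time w n) : Omega -> R).
Proof. exact: measurable_jump_time. Qed.

Let mdisc : measurable_fun setT (fun t : R => (disc t)%:E).
Proof. by apply/measurable_EFinP; exact: measurable_disc. Qed.

Let disc0 t : (0 <= (disc t)%:E)%E.
Proof. by rewrite lee_fin; exact: disc_ge0. Qed.

Lemma weight_ge0 k n (h : history S A B n) : (0 <= weight k h)%E.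
Proof. by apply: integral_ge0 => w _. Qed.

Lemma weight_fin k n (h : history S A B n) : weight k h \is a fin_num.
Proof.
rewrite ge0_fin_numE ?weight_ge0//.
apply: (@le_lt_trans _ _ (\int[P]_(w in before k h) cst 1 w)%E).
  apply: ge0_le_integral => //.
  - exact: measurable_before.
  - apply: measurable_funTS; apply: (measurableT_comp mdisc); exact: mjump.
  - by move=> w _; rewrite lee_fin disc_le1// jump_time_ge0.
rewrite integral_cst ?mul1e; last exact: measurable_before.
by rewrite -ge0_fin_numE// fin_num_measure//; exact: measurable_before.
Qed.

Lemma integral_after k n (h : history S A B n) a b :
  (\int[P]_(w in after k h a b) (disc (jump_time w n))%:E =
   (play_prob k h a b)%:E * weight k h)%E.
Proof.
rewrite -(integral_restricted_law P (measurable_after k h a b) (@mjump n)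
  mdisc disc0).
rewrite /weight -(integral_restricted_law P (measurable_before k h) (@mjump n)
  mdisc disc0).
rewrite -(@ge0_integral_mscale _ _ _ _ _ measurableT
  (NngNum (play_prob_ge0 k h a b)))//.
apply: eq_measure_integral => U mU _.
exact: prob_after.
Qed.

(** With the discount as [g] this yields the recursion for [weight], with the discounted length as
    [g] the reward of a stage. *)
Lemma integral_landing k n (h : history S A B n) a b j (g : R -> R) :
  measurable_fun setT g -> (forall t, 0 <= g t) ->
  (\int[P]_(w in landing k h a b j)
     (disc (jump_time w n) * g (sojourn w n))%:E =
   (play_prob k h a b)%:E * weight k h * \int[LS h.2 a b j]_t (g t)%:E)%E.
Proof.
move=> mg g0; rewrite -integral_after.
apply: (@integral_independent _ Omega R P (fun w => jump_time w n)
  (fun w => sojourn w n) _ _ (LS h.2 a b j)) => //.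
- exact: measurable_sojourn.
- exact: measurable_after.
- exact: measurable_landing.
- by move=> U V mU mV; exact: prob_landing.
- exact: measurable_disc.
Qed.

Lemma weight_rcons k n (h : n.-tuple (S * A * B)) i a b j :
  weight k (([tuple of rcons h (i, a, b)], j) : history S A B n.+1) =
  ((play_prob k ((h, i) : history S A B n) a b)%:E *
   weight k ((h, i) : history S A B n) * (q i a b j)%:E)%E.
Proof.
rewrite /weight before_rcons -(discounted_transitionE kerQ alpha0).
rewrite -integral_landing//; last exact: measurable_disc.
by apply: eq_integral => w _; rewrite jump_timeS discD.
Qed.

(** The law specifies only the events with initial state [i0]; summed over the types they have
    probability 1, so the other initial states are null. *)
Lemma prob_initial k i (h : 0.-tuple (S * A * B)) :
  P (before k ((h, i) : history S A B 0)) = (p k * (i == i0)%:R)%:E.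
Proof.
have E i' : before k ((h, i') : history S A B 0) =
    [set w | state w 0 = i' /\ gtype w = k] :> set Omega.
  apply/seteqP; split => w /=; first by move=> [wk] [_ <-].
  move=> [wi wk]; split => //=; rewrite -wi; congr (_, _); rewrite [h]tuple0.
  exact: tuple0.
rewrite E; have [->|ii0] := eqVneq i i0.
  by rewrite mulr1; exact: (law_initial law).
rewrite mulr0.
have mi0 : measurable ([set w | state w 0 = i0] : set Omega).
  exact: measurable_state.
have P1 : P [set w | state w 0 = i0] = 1%E.
  rewrite -(fdist_sum1 p) -sumEFin.
  set D := [set w | _] in mi0 *.
  rewrite -[D]setIT -integral_indic//.
  rewrite (@integral_fibers _ Omega R K P (@gtype R K S A B)).
  - apply: eq_bigr => k' _; rewrite integral_indic//;
      last exact: measurable_gtype.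
    exact: (law_initial law).
  - by move=> k'; exact: measurable_gtype.
  - by apply/measurable_EFinP.
  - by move=> w; rewrite lee_fin.
apply/eqP; rewrite eq_le measure_ge0 andbT.
apply: (@le_trans _ _ (P (~` [set w | state w 0 = i0]))).
  apply: le_measure; rewrite ?inE.
  - by apply: measurableI; [exact: measurable_state|exact: measurable_gtype].
  - exact: measurableC.
  - by move=> w [/= wi _] wi0; move: ii0; rewrite -wi wi0 eqxx.
by rewrite probability_setC// P1 subee.
Qed.

Lemma weight_initial k i (h : 0.-tuple (S * A * B)) :
  weight k ((h, i) : history S A B 0) = (p k * (i == i0)%:R)%:E.
Proof.
rewrite -(prob_initial k i h) /weight -[RHS]mul1e -integral_cst.
  apply: eq_integral => w _.
  by rewrite /jump_time big_nil /disc mulr0 oppr0 expR0.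
exact: measurable_before.
Qed.

Let tau k := seq_of_policy (pi k).
Let sigma := seq_of_policy sg.

(** Induction on the last move: [weight_rcons] and [stage_meanS] append it on the two sides. *)
Lemma sum_weight k n (g : seq (S * A * B) -> S -> R) :
  \sum_(h : n.-tuple (S * A * B)) \sum_i
    fine (weight k ((h, i) : history S A B n)) * g h i =
  p k * stage_mean q n g i0 (tau k) sigma.
Proof.
elim: n g => [|n IH] g.
  rewrite (big_pred1 [tuple]) => [|h]; last exact/esym/eqP/tuple0.
  under eq_bigr do rewrite weight_initial/=.
  rewrite (bigD1 i0)//= eqxx mulr1 big1 ?addr0// => i /negbTE->.
  by rewrite mulr0 mul0r.
rewrite stage_meanS -IH.
rewrite (reindex (fun z : n.-tuple (S * A * B) * (S * A * B) =>
  [tuple of rcons z.1 z.2])) /=; last first.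
  exact/onW_bij/bij_rcons_tuple.
rewrite -(pair_bigA _ (fun (h : n.-tuple (S * A * B)) (x : S * A * B) =>
  \sum_i fine (weight k (([tuple of rcons h x], i) : history S A B n.+1)) *
    g (rcons h x) i))/=.
apply: eq_bigr => h _.
rewrite sum_triple.
apply: eq_bigr => i _; rewrite mulr_sumr; apply: eq_bigr => a _.
rewrite mulr_sumr; apply: eq_bigr => b _.
rewrite mulr_sumr; apply: eq_bigr => j _.
rewrite weight_rcons -(fineK (weight_fin k _)) -!EFinM/=.
by rewrite /tau /sigma !seq_of_policyE /play_prob; ring.
Qed.

(** The reward rate is constant during a sojourn, which leaves the integral of the discount over
    it. *)
Definition sojourn_reward n (w : play R K S A B) : R :=
  c (gtype w) (state w n) (action1 w n) (action2 w n) *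
  (disc (jump_time w n) * len (sojourn w n)).

Let fiber_index n (w : play R K S A B) :
    K * (n.-tuple (S * A * B) * S) * (A * B) * S :=
  (gtype w, hist n w, (action1 w n, action2 w n), state w n.+1).

Let fiberE n k h ab j : [set w | fiber_index n w = (k, h, ab, j)] =
  landing k (h : history S A B n) ab.1 ab.2 j.
Proof.
apply/seteqP; split=> w /=; first by move=> [<- <- <- <-].
case: ab => a b [[[/= wk wh] [wa wb]] wj].
by rewrite /fiber_index wk wh wa wb wj.
Qed.

Let measurable_fiber n z :
  measurable ([set w | fiber_index n w = z] : set Omega).
Proof.
by case: z => [[[k h] ab] j]; rewrite fiberE; exact: measurable_landing.
Qed.

Let measurable_disc_length n : measurable_fun setT
  (fun w : Omega => disc (jump_time w n) * len (sojourn w n)).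
Proof.
apply: measurable_funM.
- by apply: measurableT_comp; [exact: measurable_disc|exact: mjump].
- apply: measurableT_comp; first exact: measurable_discounted_length.
  exact: measurable_sojourn.
Qed.

Lemma measurable_sojourn_reward n :
  measurable_fun setT (sojourn_reward n : Omega -> R).
Proof.
apply: measurable_funM.
  pose phi (z : K * (n.-tuple (S * A * B) * S) * (A * B) * S) :=
    c z.1.1.1 z.1.1.2.2 z.1.2.1 z.1.2.2.
  rewrite (_ : (fun w => _) = phi \o fiber_index n)//.
  move=> _ U mU; rewrite setTI.
  rewrite (_ : _ @^-1` _ = \bigcup_(z in [set z | U (phi z)])
     [set w | fiber_index n w = z]).
    apply: fin_bigcup_measurable; first exact: finite_finset.
    by move=> z _; exact: measurable_fiber.
  apply/seteqP; split=> [w /= Uw|w [z Uz /= wz]].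
    by exists (fiber_index n w).
  by rewrite wz.
exact: measurable_disc_length.
Qed.

Lemma sojourn_reward_ge0 n w : 0 <= sojourn_reward n w.
Proof.
by rewrite mulr_ge0// mulr_ge0 ?disc_ge0// discounted_length_ge0.
Qed.

Let r k i a b := c k i a b * m i a b.

(** On each landing event the integral factorizes; the sum over the next state [j] then produces
    [mean_discount]. *)
Lemma integral_sojourn_reward n : (\int[P]_w (sojourn_reward n w)%:E =
  (\sum_k p k * stage_mean q n (fun s i => \sum_a \sum_b
     tau k s i a * sigma s i b * r k i a b) i0 (tau k) sigma)%:E)%E.
Proof.
rewrite (@integral_fibers _ Omega R _ P (fiber_index n)); last 3 first.
- exact: measurable_fiber.
- by apply/measurable_EFinP; exact: measurable_sojourn_reward.
- by move=> w; rewrite lee_fin sojourn_reward_ge0.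
pose piece k (h : n.-tuple (S * A * B) * S) a b j :=
  ((c k h.2 a b)%:E * ((play_prob k (h : history S A B n) a b)%:E *
    weight k (h : history S A B n) *
    \int[LS h.2 a b j]_t (len t)%:E))%E.
have mlen : measurable_fun setT len by exact: measurable_discounted_length.
have len0 t : 0 <= len t by exact: discounted_length_ge0.
transitivity (\sum_(z : K * (n.-tuple (S * A * B) * S) * (A * B) * S)
    piece z.1.1.1 z.1.1.2 z.1.2.1 z.1.2.2 z.2)%E.
  apply: eq_bigr => -[[[k h] [a b]] j] _; rewrite fiberE/= /piece.
  rewrite -integral_landing// -ge0_integralZl//; last 4 first.
  - exact: measurable_landing.
  - apply/measurable_EFinP; apply: measurable_funTS.
    exact: measurable_disc_length.
  - by move=> w _; rewrite lee_fin mulr_ge0// disc_ge0.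
  - by rewrite lee_fin.
  apply: eq_integral => w; rewrite inE => -[[[/= wk <-] [wa wb]] _].
  by rewrite /sojourn_reward wk wa wb EFinM.
transitivity (\sum_k \sum_(h : n.-tuple (S * A * B)) \sum_i \sum_a \sum_b
  \sum_j piece k (h, i) a b j)%E.
  rewrite -(pair_bigA _ (fun (y : K * (n.-tuple (S * A * B) * S) * (A * B)) j =>
    piece y.1.1 y.1.2 y.2.1 y.2.2 j))/=.
  rewrite -(pair_bigA _ (fun (y : K * (n.-tuple (S * A * B) * S))
      (ab : A * B) => \sum_j piece y.1 y.2 ab.1 ab.2 j))%E/=.
  rewrite -(pair_bigA _ (fun k (h : n.-tuple (S * A * B) * S) =>
    \sum_(ab : A * B) \sum_j piece k h ab.1 ab.2 j))%E/=.
  apply: eq_bigr => k _; rewrite [RHS]pair_bigA/=.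
  apply: eq_bigr => -[h i] _ /=.
  by rewrite [RHS]pair_bigA.
rewrite -sumEFin; apply: eq_bigr => k _.
rewrite -sum_weight -sumEFin; apply: eq_bigr => h _.
rewrite -sumEFin; apply: eq_bigr => i _.
rewrite mulr_sumr -sumEFin; apply: eq_bigr => a _.
rewrite mulr_sumr -sumEFin; apply: eq_bigr => b _.
rewrite /piece/=.
under eq_bigr do rewrite -(fineK (weight_fin k _)) -EFinM muleA -EFinM.
rewrite -ge0_sume_distrr; last first.
  by move=> j _; apply: integral_ge0 => t _; rewrite lee_fin.
rewrite mean_discountE// -EFinM; congr EFin.
by rewrite /tau /sigma !seq_of_policyE /play_prob /r; ring.
Qed.

End law.

(** * The reward along a single play *)

Section path_reward.
Variables (R : realType) (K S A B : finPointedType).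
Variables (c : K -> S -> A -> B -> R) (alpha : R).
Hypotheses (c0 : forall k i a b, 0 <= c k i a b) (alpha0 : 0 < alpha).
Implicit Type w : play R K S A B.
Local Notation mu := (@lebesgue_measure R).

Let stay w n : set R := `[jump_time w n, jump_time w n.+1[%classic.

(** [epoch] is a chosen index; monotonicity of the jump times leaves no other candidate. *)
Lemma epochE w n t : stay w n t -> epoch w t = n.
Proof.
rewrite /stay/= in_itv/= => /andP[nt tn].
apply: get_unique => /= [|k /andP[kt tk]]; first by rewrite nt.
apply/eqP; rewrite eqn_leq; apply/andP; split; rewrite leqNgt; apply/negP.
- by move=> /(jump_time_nd w); rewrite leNgt (le_lt_trans kt tn).
- by move=> /(jump_time_nd w); rewrite leNgt (le_lt_trans nt tk).
Qed.

Let trivIset_stay w : trivIset setT (stay w).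
Proof.
apply/trivIsetP => m n _ _ mn; apply/seteqP; split => // t [tm tn].
by move: mn; rewrite -(epochE tm) -(epochE tn) eqxx.
Qed.

Let stay_cover w :
  [set t | 0 <= t /\ (t%:E < explosion_time w)%E] = \bigcup_n stay w n.
Proof.
have cvgT : cvgn (fun n => (jump_time w n)%:E).
  apply: ereal_nondecreasing_is_cvgn => m n mn; rewrite lee_fin.
  exact: jump_time_nd.
apply/seteqP; split=> [t [/= t0 tT]|t [n _]].
- have [n tn] : exists n, t < jump_time w n.
    apply: contrapT => /forallNP h; move: tT; apply/negP; rewrite -leNgt.
    apply: lime_le => //; near=> n; rewrite lee_fin leNgt; exact/negP.
  have ex : exists n, t < jump_time w n by exists n.
  (* The least index whose jump time exceeds [t] is not 0, since the jump time of index 0 is 0; its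
     predecessor is the epoch of [t]. *)
  case: (ex_minnP ex) => -[|k] kt kmin.
    by move: kt; rewrite /jump_time big_nil ltNge t0.
  exists k => //; rewrite /stay/= in_itv/= kt andbT leNgt.
  by apply/negP => /kmin; rewrite ltnn.
- rewrite /stay/= in_itv/= => /andP[nt tn]; split.
    exact: le_trans (jump_time_ge0 w n) nt.
  apply: (@lt_le_trans _ _ (jump_time w n.+1)%:E); first by rewrite lte_fin.
  apply: lime_ge => //; near=> m; rewrite lee_fin.
  by apply: jump_time_nd; near: m; exact: nbhs_infty_ge.
Unshelve. all: by end_near. Qed.

Lemma discounted_rewardE w : discounted_reward c alpha w =
  (\sum_(n <oo) (sojourn_reward c alpha n w)%:E)%E.
Proof.
rewrite /discounted_reward stay_cover.
have stayE n t : stay w n t ->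
    expR (- (alpha * t)) * c (gtype w) (state w (epoch w t))
      (action1 w (epoch w t)) (action2 w (epoch w t)) =
    c (gtype w) (state w n) (action1 w n) (action2 w n) * disc alpha t.
  by move=> /epochE ->; rewrite mulrC.
have mstay n : measurable_fun (stay w n) (fun t : measurableTypeR R =>
    (c (gtype w) (state w n) (action1 w n) (action2 w n) * disc alpha t)%:E).
  apply/measurable_EFinP; apply: measurable_funTS.
  by apply: measurable_funM => //; exact: measurable_disc.
have mS k : measurable (stay w k : set (measurableTypeR R)).
  exact: measurable_itv.
have mf : measurable_fun (\bigcup_n stay w n) (fun t : measurableTypeR R =>
    (expR (- (alpha * t)) * c (gtype w) (state w (epoch w t))
      (action1 w (epoch w t)) (action2 w (epoch w t)))%:E).
  apply/(measurable_fun_bigcup _ mS) => n.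
  apply: eq_measurable_fun (mstay n) => t; rewrite inE => tn.
  by rewrite (stayE n).
rewrite ge0_integral_bigcup//.
- apply: eq_eseriesr => n _.
  transitivity (\int[mu]_(t in stay w n)
    ((c (gtype w) (state w n) (action1 w n) (action2 w n))%:E *
     (disc alpha t)%:E))%E.
    apply: eq_integral => t; rewrite inE => tn.
    by rewrite (stayE n)// EFinM.
  rewrite ge0_integralZl//; last 3 first.
  - by apply/measurable_EFinP; apply: measurable_funTS; exact: measurable_disc.
  - by move=> t _; rewrite lee_fin disc_ge0.
  - by rewrite lee_fin.
  rewrite /stay integral_disc_itv//; last exact: jump_time_nd.
  rewrite -EFinM; congr (_ * _)%:E.
  rewrite /discounted_length max_r ?sojourn_ge0// jump_timeS discD; ring.
- by move=> t _; rewrite lee_fin mulr_ge0// expR_ge0.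
Qed.

End path_reward.

Section payoff.
Variables (R : realType) (K S A B : finPointedType).
Variables (Q : kernel_on R S A B) (c : K -> S -> A -> B -> R) (alpha : R).
Hypotheses (kerQ : semi_markov_kernel Q) (alpha0 : 0 < alpha).
Hypothesis c0 : forall k i a b, 0 <= c k i a b.
Variables (beta M : R).
Local Notation q := (discounted_transition Q alpha).
Local Notation r := (fun k i a b => c k i a b * mean_discount Q alpha i a b).
Hypothesis q_beta : forall i a b, \sum_j q i a b j <= beta.
Hypothesis M0 : 0 <= M.
Hypothesis rM : forall k i a b, r k i a b + beta * M <= M.

(** Monotone convergence exchanges the sum over sojourns with the expectation; its partial sums are
    the truncated rewards averaged over the types. *)
Lemma payoffE (P : probability (Omega R K S A B) R) (p : fdist R K) (i : S)
    (pi : policy1 R K S A B) (sg : policy2 R S A B) :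
  is_game_law Q p i pi sg P ->
  (\int[P]_w discounted_reward c alpha w)%E =
  (pay r q p i (fun k => seq_of_policy (pi k)) (seq_of_policy sg))%:E.
Proof.
move=> law.
under eq_integral do rewrite discounted_rewardE//.
rewrite integral_nneseries//; last 2 first.
- by move=> n; apply/measurable_EFinP; exact: measurable_sojourn_reward.
- by move=> n w _; rewrite lee_fin sojourn_reward_ge0.
under eq_eseriesr do rewrite (integral_sojourn_reward kerQ alpha0 c0 law).
apply/cvg_lim => //.
rewrite (_ : (fun N => _) = (fun N => (\sum_k p k * stage_reward r q N k i
  (seq_of_policy (pi k)) (seq_of_policy sg))%:E)); last first.
  apply/funext => N; rewrite sumEFin big_mkord exchange_big/=; congr EFin.
  by apply: eq_bigr => k _; rewrite -mulr_sumr (stage_reward_mean r).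
apply: cvg_EFin; first by near=> n.
suff h : \sum_k p k * stage_reward r q N k i (seq_of_policy (pi k))
    (seq_of_policy sg) @[N --> \oo] --> pay r q p i
    (fun k => seq_of_policy (pi k)) (seq_of_policy sg) by exact: h.
rewrite /pay; apply: cvgn_sum => k; apply: cvgMr.
have q0 := discounted_transition_ge0 Q alpha.
have r0 k' i' a b : 0 <= r k' i' a b by rewrite mulr_ge0// mean_discount_ge0.
exact: (@cvg_stage_reward _ _ _ _ _ r q beta M).
Unshelve. all: by end_near. Qed.

End payoff.

(** * The optimality equation *)

(** Transfers suprema and infima along a surjection: from policies to sequence-indexed ones, and
    from families over [S] to their values at one state. *)
Lemma eq_range_surj (T T' U : Type) (g : T -> T') (g' : T' -> T)
    (F : T -> U) (F' : T' -> U) :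
  cancel g' g -> (forall x, F x = F' (g x)) -> range F = range F'.
Proof.
move=> gK FF'; apply/seteqP; split=> _ [x _ <-]; first by exists (g x).
by exists (g' x); rewrite ?FF' ?gK.
Qed.

Lemma TmunuE (R : realType) (K S A B : finPointedType) (Q : kernel_on R S A B)
    (c : K -> S -> A -> B -> R) (alpha : R) (p0 : fdist R K) mu nu u p i :
  Tmunu Q c alpha p0 mu nu u p i =
  bellman (fun k i a b => c k i a b * mean_discount Q alpha i a b)
    (discounted_transition Q alpha) p0 u p i (fun k => mu k i) (nu i).
Proof.
rewrite /Tmunu /bellman /one_stage -big_split; apply: eq_bigr => k _.
rewrite -big_split mulr_sumr; apply: eq_bigr => a _.
rewrite -big_split !mulr_sumr; apply: eq_bigr => b _ /=.
ring.
Qed.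

Theorem theorem3p1 (R : realType) (K S A B : finPointedType)
    (Q : kernel_on R S A B) (c : K -> S -> A -> B -> R) (alpha : R)
    (Pr : fdist R K -> S -> policy1 R K S A B -> policy2 R S A B ->
          probability (Omega R K S A B) R)
    (p0 : fdist R K) (delta eps : R) :
  semi_markov_kernel Q ->
  (forall k i a b, 0 <= c k i a b) ->
  0 < alpha ->
  (forall p i pi sg, is_game_law Q p i pi sg (Pr p i pi sg)) ->
  0 < delta ->
  0 < eps < 1 ->
  (forall i a b, sojourn_cdf Q i a b delta <= 1 - eps) ->
  exists Vstar : fdist R K -> S -> R,
    is_value_function c alpha Pr Vstar /\
    forall p i,
      (Vstar p i)%:E = Tupper Q c alpha p0 Vstar p i /\
      (Vstar p i)%:E = Tlower Q c alpha p0 Vstar p i.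
Proof.
move=> kerQ c0 alpha0 law delta0 /andP[eps0 eps1] DQ.
pose q := discounted_transition Q alpha.
pose r k i a b := c k i a b * mean_discount Q alpha i a b.
have q0 i a b j : 0 <= q i a b j by exact: discounted_transition_ge0.
have r0 k i a b : 0 <= r k i a b by rewrite mulr_ge0// mean_discount_ge0.
(* The contraction factor supplied by [discounted_transition_sum_le]. *)
pose beta := 1 - eps * (1 - disc alpha delta).
have d1 : disc alpha delta < 1.
  by rewrite -expR0 ltr_expR oppr_lt0 mulr_gt0.
have beta1 : beta < 1 by rewrite /beta; nra.
have q_beta i a b : \sum_j q i a b j <= beta.
  by apply: discounted_transition_sum_le => //; exact: ltW.
(* The sum of all stage rewards is a convenient bound on each of them, and [M] below solves
   [rmax + beta * M = M]. *)
pose rmax := \sum_(x : K * S * A * B) r x.1.1.1 x.1.1.2 x.1.2 x.2.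
have rmax0 : 0 <= rmax by apply: sumr_ge0.
pose M := rmax / (1 - beta).
have M0 : 0 <= M by rewrite divr_ge0// subr_ge0 ltW.
have rM k i a b : r k i a b + beta * M <= M.
  rewrite -lerBrDr -[X in X - _]mul1r -mulrBl mulrC divfK; last first.
    by rewrite subr_eq0 gt_eqF.
  rewrite /rmax (bigD1 (k, i, a, b))//= lerDl.
  by apply: sumr_ge0.
have payE p i pi sg : payoff c alpha Pr p i pi sg =
    (pay r q p i (fun k => seq_of_policy (pi k)) (seq_of_policy sg))%:E.
  exact: (payoffE kerQ alpha0 c0 q_beta M0 rM (law p i pi sg)).
pose g1 (pi : policy1 R K S A B) k := seq_of_policy (pi k).
pose g1' (tau : K -> seq_policy R S A B A) : policy1 R K S A B :=
  fun k => policy_of_seq (tau k).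
have g1K : cancel g1' g1 by [].
have g2K : cancel (@policy_of_seq R S A B B) (@seq_of_policy R S A B B) by [].
exists (lower r q); split=> p i.
  split.
    rewrite -(ereal_lower_value q0 q_beta M0 rM).
    congr ereal_sup; apply: (eq_range_surj g1K) => pi.
    by congr ereal_inf; apply: (eq_range_surj g2K) => sg; exact: payE.
  rewrite -(ereal_upper_value r0 q0 q_beta beta1 M0 rM p0).
  congr ereal_inf; apply: (eq_range_surj g2K) => sg.
  by congr ereal_sup; apply: (eq_range_surj g1K) => pi; exact: payE.
have [Eu El] := bellman_lower r0 q0 q_beta beta1 M0 rM p0 p i.
(* Only the values of [mu] and [nu] at [i] enter the operator, and constant families realize all
   such values. *)
have h1K : cancel (fun mu k (_ : S) => mu k)
  (fun (mu : K -> S -> fdist R A) k => mu k i) by [].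
have h2K : cancel (fun nu (_ : S) => nu) (fun nu : S -> fdist R B => nu i).
  by [].
split.
- rewrite -{1}Eu; apply/esym.
  congr ereal_inf; apply: (eq_range_surj h2K) => nu.
  by congr ereal_sup; apply: (eq_range_surj h1K) => mu; rewrite TmunuE.
- rewrite -{1}El; apply/esym.
  congr ereal_sup; apply: (eq_range_surj h1K) => mu.
  by congr ereal_inf; apply: (eq_range_surj h2K) => nu; rewrite TmunuE.
Qed.
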